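(* Let $n\ge3$ and $y=(y_1,\dots,y_{n-1},q)\in\mathcal{J}_n\subset\widetilde{\mathbb{G}}_n$. Then $$\mathcal{C}_{\widetilde{\mathbb{G}}_n}(0,y)=\mathcal{L}_{\widetilde{\mathbb{G}}_n}(0,y)=\max_{1\le j\le n-1}\left\{\tanh^{-1}\frac{\binom nj\,|y_j-\bar y_{n-j}q|+\big|y_jy_{n-j}-\binom nj^2q\big|}{\binom nj^2-|y_{n-j}|^2}\right\}.$$
   Context: $\mathbb{D}$ is the open unit disc in $\mathbb{C}$, $[\cdot]$ the integer part, and $\mathcal{O}(X,Y)$ the set of holomorphic maps from $X$ to $Y$. The extended symmetrized polydisc is $$\widetilde{\mathbb{G}}_n=\Big\{(y_1,\dots,y_{n-1},q)\in\mathbb{C}^n:\ |q|<1,\ \exists\,\beta_1,\dots,\beta_{n-1}\in\mathbb{C}\text{ with } y_j=\beta_j+\bar\beta_{n-j}q,\ |\beta_j|+|\beta_{n-j}|<\tbinom{n}{j},\ 1\le j\le n-1\Big\}.$$ For $n\ge3$ odd, $$\mathcal{J}_n=\Big\{(y_1,\dots,y_{n-1},q)\in\widetilde{\mathbb{G}}_n:\ y_j=\tfrac{\binom nj}{n}y_1,\ y_{n-j}=\tfrac{\binom nj}{n}y_{n-1},\ 2\le j\le[\tfrac n2]\Big\},$$ and for $n\ge4$ even, $$\mathcal{J}_n=\Big\{(y_1,\dots,y_{n-1},q)\in\widetilde{\mathbb{G}}_n:\ y_{[\frac n2]}=\tbinom n{[\frac n2]}\tfrac{y_1+y_{n-1}}{2n},\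 y_j=\tfrac{\binom nj}{n}y_1,\ y_{n-j}=\tfrac{\binom nj}{n}y_{n-1},\ 2\le j\le[\tfrac n2]-1\Big\}.$$ For a domain $\Omega\subset\mathbb{C}^n$ and $z,w\in\Omega$, the Carathéodory pseudo-distance is $$\mathcal{C}_\Omega(z,w)=\sup\{\rho(f(z),f(w)):f\in\mathcal{O}(\Omega,\mathbb{D})\},$$ and the Lempert function is $$\mathcal{L}_\Omega(z,w)=\inf\{\rho(\alpha,\beta):\alpha,\beta\in\mathbb{D},\ \exists f\in\mathcal{O}(\mathbb{D},\Omega)\text{ with } f(\alpha)=z,\ f(\beta)=w\},$$ where $\rho$ is the hyperbolic distance on $\mathbb{D}$, $\rho(z,w)=\tanh^{-1}\left|\dfrac{z-w}{1-\bar wz}\right|$. *)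

(* Defs.v *)
From HB Require Import structures.
From mathcomp Require Import all_boot all_order all_algebra.
From mathcomp Require Import complex.
From mathcomp Require Import all_classical all_reals all_analysis.

Set Implicit Arguments.
Unset Strict Implicit.
Unset Printing Implicit Defensive.

Import Order.TTheory GRing.Theory Num.Theory.
Import numFieldNormedType.Exports.

Local Open Scope classical_set_scope.
Local Open Scope ring_scope.

(* The generic norm `|z| on R[i] takes its values in R[i]; this is the usual
   modulus sqrt (Re z ^ 2 + Im z ^ 2), as an element of R. *)
Definition cmod {R : realType} (z : R[i]) : R := Normc.normc z.

(* Inverse hyperbolic tangent on ]-1, 1[; junk values elsewhere. *)
Definition atanh {R : realType} (t : R) : R := ln ((1 + t) / (1 - t)) / 2.

Definition rho {R : realType} (z w : R[i]) : R :=
  atanh (cmod ((z - w) / (1 - w^* * z))).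

(* The algebra R[i]^o is R[i] seen as a normed space over itself. *)
Definition unit_disc (R : realType) : set (R[i]^o) := [set z | cmod z < 1].
Arguments unit_disc : clear implicits.

(* For open X.  A map on X is represented by a total function whose values
   outside X are irrelevant: since X is open, differentiability at a point of X
   depends only on the restriction to X.  The normed spaces are over R[i], so
   that the differential is complex linear. *)
Definition holo {R : realType} {V W : normedModType R[i]}
    (X : set V) (Y : set W) : set (V -> W) :=
  [set f | forall z, X z -> differentiable f z /\ Y (f z)].

Definition caratheodory {R : realType} {V : normedModType R[i]}
    (Omega : set V) (z w : V) : \bar R :=
  ereal_sup [set (rho (f z) (f w))%:E | f in holo Omega (unit_disc R)].

Definition lempert {R : realType} {V : normedModType R[i]}
    (Omega : set V) (z w : V) : \bar R :=
  ereal_inf [set r : \bar R | exists a b : R[i]^o,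
    [/\ unit_disc R a, unit_disc R b,
        exists f, [/\ holo (unit_disc R) Omega f, f a = z & f b = w]
      & r = (rho a b)%:E]].

(* Coordinates numbered from 1: (y_1, ..., y_(n-1), q) has y_k = ycoord y k for
   1 <= k <= n - 1 and q = ycoord y n.  Only meaningful for 1 <= k <= n. *)
Definition ycoord {R : realType} {n : nat} (y : 'rV[R[i]]_n) (k : nat) : R[i] :=
  if insub k.-1 is Some i then y ord0 i else 0.

Definition ext_sym_polydisc (R : realType) (n : nat) : set 'rV[R[i]]_n :=
  [set y | let q := ycoord y n in
    cmod q < 1 /\
    exists beta : nat -> R[i], forall j : nat, (1 <= j <= n.-1)%N ->
      ycoord y j = beta j + (beta (n - j)%N)^* * q /\
      cmod (beta j) + cmod (beta (n - j)%N) < 'C(n, j)%:R].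
Arguments ext_sym_polydisc : clear implicits.

Definition Jset (R : realType) (n : nat) : set 'rV[R[i]]_n :=
  [set y | [/\ ext_sym_polydisc R n y,
    (forall j : nat, (2 <= j <= if odd n then n./2 else n./2.-1)%N ->
       ycoord y j = 'C(n, j)%:R / n%:R * ycoord y 1 /\
       ycoord y (n - j) = 'C(n, j)%:R / n%:R * ycoord y n.-1)
    & ~~ odd n ->
       ycoord y n./2 =
         'C(n, n./2)%:R * ((ycoord y 1 + ycoord y n.-1) / (2 * n)%:R)]].
Arguments Jset : clear implicits.

(* Main.v *)
Require Import Defs.
From mathcomp Require Import all_boot all_order all_algebra.
From mathcomp Require Import complex.
From mathcomp Require Import all_classical all_reals all_analysis.
From mathcomp Require Import ring lra zify.
Import Order.TTheory GRing.Theory Num.Theory.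
Import numFieldNormedType.Exports.
Local Open Scope classical_set_scope.
Local Open Scope ring_scope.

(** Write [a = y_1 / n], [b = y_(n-1) / n].  A point of [J_n] is determined by
    [(a, b, q)], which runs over the tetrablock
    [{(b1 + b2^* q, b2 + b1^* q, q) : |q| < 1, |b1| + |b2| < 1}], and the
    inclusion of the tetrablock as [J_n] is linear.  So an analytic disc of the
    tetrablock is an analytic disc of the extended symmetrized polydisc, and a
    chain of three inequalities closes up:
    max of the formula <= Caratheodory <= Lempert <= max of the formula.

    First inequality ([le_caratheodory]).  For [|z| = 1] the function
    [(c q z - y_j) / (y_(n-j) z - c)], with [c] the binomial coefficient of
    index [j], maps the domain into the disc and the origin to [0]
    ([magic_numerator_lt]).  As [z] describes the circle its value at [y]
    describes a circle, whose point of largest modulus gives exactly the [j]-th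
    term of the maximum ([magic_extremal]).

    Second inequality ([caratheodory_le_lempert]).  This is the Schwarz-Pick
    lemma for maps of the disc that are only assumed to be complex
    differentiable at each point.  Goursat's theorem on rectangles
    ([goursat_rectangle]), applied to [h (exp (x + iy))] on rectangles of height
    [2 pi], gives the maximum principle at the centre of the disc
    ([cmod_center_le]), from which [schwarz_lemma] follows.

    Third inequality.  Exchanging [a] and [b] if necessary, assume
    [|b| <= |a|] and let [m] be the term of index [1].  The disc
    [t -> (t (1 - s), kappa t (1 - s), t (kappa t - s)) / (1 - s kappa t)],
    with [0 <= s <= 1] and [|kappa| <= 1], stays in the tetrablock
    ([disc_tetrablock]) and vanishes at [0]; up to rotations of the coordinates
    one of these discs passes through [(a, b, q)] at [t = m]
    ([disc_through_origin_and]).  The shape of these discs comes from the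
    Moebius maps [z -> (a - q z) / (1 - b z)], which send the closed disc into the
    closed disc of radius [m] and touch its boundary: divided by [m] and rotated
    they fix [1], hence, unless they are constant, become affine maps
    [w -> mu w + nu] of the right half-plane, with [mu > 0] necessarily constant
    along a holomorphic family and [nu] holomorphic with nonnegative real part.
    Taking [nu] extremal with [nu = mu - 1] at the origin gives the formula,
    with [s = 1 / mu]. *)

Set Implicit Arguments.
Unset Strict Implicit.
Unset Printing Implicit Defensive.

Local Notation Re := complex.Re.
Local Notation Im := complex.Im.

(** * Complex numbers with real moduli *)

Section Modulus.
Variable R : realType.
Implicit Types (z w : R[i]) (x : R).

Lemma normr_cmod z : `|z| = (cmod z)%:C%C.
Proof. by []. Qed.

Lemma cmod_ge0 z : 0 <= cmod z.
Proof. by case: z => a b; rewrite sqrtr_ge0. Qed.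

Lemma cmod0 : cmod (0 : R[i]) = 0. Proof. exact: Normc.normc0. Qed.
Lemma cmod1 : cmod (1 : R[i]) = 1. Proof. exact: Normc.normc1. Qed.
Lemma cmodM z w : cmod (z * w) = cmod z * cmod w. Proof. exact: Normc.normcM. Qed.
Lemma cmodV z : cmod z^-1 = (cmod z)^-1. Proof. exact: Normc.normcV. Qed.
Lemma cmodN z : cmod (- z) = cmod z. Proof. exact: normcN. Qed.

Lemma cmod_eq0 z : (cmod z == 0) = (z == 0).
Proof.
apply/eqP/eqP => [/Normc.eq0_normc //|->]; exact: cmod0.
Qed.

Lemma cmod_gt0 z : (0 < cmod z) = (z != 0).
Proof. by rewrite lt_def cmod_eq0 cmod_ge0 andbT. Qed.

Lemma cmodB z w : cmod (z - w) = cmod (w - z).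
Proof. by rewrite -cmodN opprB. Qed.

Lemma cmodD z w : cmod (z + w) <= cmod z + cmod w.
Proof. exact: le_normcD. Qed.

Lemma cmodX z n : cmod (z ^+ n) = cmod z ^+ n.
Proof.
elim: n => [|n IH]; first by rewrite !expr0 cmod1.
by rewrite !exprS cmodM IH.
Qed.

Lemma cmod_sq z : cmod z ^+ 2 = Re z ^+ 2 + Im z ^+ 2.
Proof. by case: z => a b; rewrite sqr_sqrtr // addr_ge0 ?sqr_ge0. Qed.

Lemma cmod_real x : cmod (x%:C)%C = `|x|.
Proof. by rewrite /cmod /= expr0n /= addr0 sqrtr_sqr. Qed.

Lemma cmod_nat n : cmod (n%:R : R[i]) = n%:R.
Proof.
have -> : (n%:R : R[i]) = (n%:R%:C)%C by rewrite rmorph_nat.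
by rewrite cmod_real ger0_norm ?ler0n.
Qed.

Lemma cmod_conj z : cmod z^* = cmod z.
Proof. by apply: (@complexI R); rewrite -!normr_cmod norm_conjC. Qed.

Lemma conj_real x : (x%:C%C)^* = x%:C%C.
Proof. exact: conjc_real. Qed.

Lemma real_complexD (x x' : R) : (x + x')%:C%C = x%:C%C + x'%:C%C.
Proof. exact: rmorphD. Qed.
Lemma real_complexB (x x' : R) : (x - x')%:C%C = x%:C%C - x'%:C%C.
Proof. exact: rmorphB. Qed.
Lemma real_complexM (x x' : R) : (x * x')%:C%C = x%:C%C * x'%:C%C.
Proof. exact: rmorphM. Qed.
Lemma real_complexX (x : R) n : (x ^+ n)%:C%C = x%:C%C ^+ n.
Proof. exact: rmorphXn. Qed.

Lemma conjD z w : (z + w)^* = z^* + w^*. Proof. exact: rmorphD. Qed.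
Lemma conjB z w : (z - w)^* = z^* - w^*. Proof. exact: rmorphB. Qed.
Lemma conjN z : (- z)^* = - z^*. Proof. exact: rmorphN. Qed.
Lemma conjM z w : (z * w)^* = z^* * w^*. Proof. exact: rmorphM. Qed.
Lemma conjV z : (z^-1)^* = (z^*)^-1. Proof. exact: fmorphV. Qed.
Lemma conj0 : (0 : R[i])^* = 0. Proof. exact: rmorph0. Qed.
Lemma conj1 : (1 : R[i])^* = 1. Proof. exact: rmorph1. Qed.
Definition conjE := (conjD, conjB, conjN, conjM, conjV, conj1, conj_real, @conjCK R[i]).

Lemma mul_conj z : z * z^* = ((cmod z) ^+ 2)%:C%C.
Proof. by rewrite -normCK normr_cmod rmorphXn. Qed.

Lemma Re_le_cmod z : Re z <= cmod z.
Proof.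
apply: le_trans (ler_norm _) _.
by have := normc_ge_Re z; rewrite normr_cmod lecR.
Qed.

Lemma Im_le_cmod z : `|Im z| <= cmod z.
Proof.
case: z => a b; rewrite /cmod /= -sqrtr_sqr ler_wsqrtr // lerDr sqr_ge0 //.
Qed.

Lemma normRe_le_cmod z : `|Re z| <= cmod z.
Proof. by have := normc_ge_Re z; rewrite normr_cmod lecR. Qed.

Lemma cmod_le_ReIm z : cmod z <= `|Re z| + `|Im z|.
Proof.
case: z => a b /=; rewrite -[leRHS]ger0_norm ?addr_ge0 // -sqrtr_sqr.
apply: ler_wsqrtr; rewrite sqrrD !real_normK ?num_real //.
by rewrite -addrA (lerD2l (a ^+ 2)) lerDr mulrn_wge0 // mulr_ge0.
Qed.

Lemma ler_cmodB z w : cmod z - cmod w <= cmod (z - w).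
Proof. by rewrite lerBlDr; have := cmodD (z - w) w; rewrite subrK. Qed.

Lemma polar_form z : exists2 w, cmod w = 1 & z = w * (cmod z)%:C%C.
Proof.
have [->|z0] := eqVneq z 0; first by exists 1; rewrite ?cmod1 // cmod0 mulr0.
have n0 : cmod z != 0 by rewrite cmod_eq0.
exists (z / (cmod z)%:C%C).
  by rewrite cmodM cmodV cmod_real ger0_norm ?cmod_ge0 // divff.
by rewrite divfK //; apply: contraNneq n0 => -[->].
Qed.

Lemma cmod_sqr_lt1 z : cmod z < 1 -> cmod z ^+ 2 < 1.
Proof. by move=> z1; rewrite expr_lt1 // cmod_ge0. Qed.

End Modulus.

(** * Complex differentiability *)

(** An arbitrary normed space as source, so that these lemmas serve functions of
    one variable and of the row vector of coordinates alike. *)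
Section ScalarCalculus.
Variables (K : numFieldType) (V : normedModType K).
Implicit Types (f g : V -> K^o).

Lemma continuous_mul f g z : {for z, continuous f} -> {for z, continuous g} ->
  {for z, continuous (fun z => f z * g z : K^o)}.
Proof. by move=> cf cg; exact: cvgM. Qed.

Lemma continuous_pow f z n : {for z, continuous f} ->
  {for z, continuous (fun z => f z ^+ n : K^o)}.
Proof.
move=> cf; elim: n => [|n IH]; first exact: cst_continuous.
have -> : (fun z => f z ^+ n.+1 : K^o) = (fun z => f z * f z ^+ n).
  by apply/funext => u; rewrite exprS.
exact: continuous_mul.
Qed.

Lemma differentiable_id (z : K^o) : differentiable (fun z : K^o => z) z.
Proof. by []. Qed.

Lemma differentiable_mul f g z : differentiable f z -> differentiable g z ->
  differentiable (fun z => f z * g z : K^o) z.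
Proof. by move=> df dg; exact: (@differentiableM K V f g z df dg). Qed.

Lemma differentiable_inv f z : differentiable f z -> f z != 0 ->
  differentiable (fun z => (f z)^-1 : K^o) z.
Proof. by move=> df dg; exact: (@differentiableV K V f z df dg). Qed.

Lemma differentiable_sub f g z : differentiable f z -> differentiable g z ->
  differentiable (fun z => f z - g z : K^o) z.
Proof. by move=> df dg; exact: (@differentiableB K V K^o f g z df dg). Qed.

Lemma differentiable_pow f z n : differentiable f z ->
  differentiable (fun z => f z ^+ n : K^o) z.
Proof.
move=> df; elim: n => [|n IH]; first exact: differentiable_cst.
have -> : (fun z => f z ^+ n.+1 : K^o) = (fun z => f z * f z ^+ n).
  by apply/funext => u; rewrite exprS.
exact: differentiable_mul.
Qed.

End ScalarCalculus.

Section Differentiability.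
Variable R : realType.

(** The tolerances are real numbers and the derivative is named: this is the form
    in which Goursat's argument uses differentiability. *)
Definition cderiv (f : R[i] -> R[i]) (z b : R[i]) :=
  forall e : R, 0 < e -> exists2 d : R, 0 < d & forall w,
    cmod (w - z) < d -> cmod (f w - f z - b * (w - z)) <= e * cmod (w - z).

Lemma nbhs_cmod (z : R[i]^o) (P : set R[i]^o) : nbhs z P ->
  exists2 d : R, 0 < d & forall w, cmod (w - z) < d -> P w.
Proof.
move=> /nbhs_ballP [e /= e0 H].
have /complex_realP[d de] : e \is Num.real by exact: gtr0_real.
exists d; first by rewrite -ltcR -de.
by move=> w wd; apply: H; rewrite /ball /= distrC normr_cmod de ltcR.
Qed.

Lemma cmod_nbhs (z : R[i]^o) (P : set R[i]^o) (d : R) : 0 < d ->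
  (forall w, cmod (w - z) < d -> P w) -> nbhs z P.
Proof.
move=> d0 H; apply/nbhs_ballP; exists (d%:C)%C => /=; first by rewrite ltcR.
by move=> w; rewrite /ball /= distrC normr_cmod ltcR => /H.
Qed.

Lemma differentiable_cderiv (f : R[i]^o -> R[i]^o) (z : R[i]^o) :
  differentiable f z -> exists b, cderiv f z b.
Proof.
move=> /derivable1_diffP df; exists ('D_1 f z) => e e0.
have /cvgrPdist_le H := df.
have := H (e%:C)%C; rewrite ltcR => /(_ e0); rewrite near_withinE => /nbhs_cmod [d d0 K].
exists d => // w wd.
have [->|wz] := eqVneq w z; first by rewrite !subrr mulr0 subrr cmod0 mulr0.
have wz0 : w - z != 0 by rewrite subr_eq0.
have := K (w - z); rewrite subr0 => /(_ wd wz0).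
rewrite normr_cmod lecR => L.
have -> : f w - f z - 'D_1 f z * (w - z) =
  - (('D_1 f z - (w - z)^-1 *: (f ((w - z)%:A + z) - f z)) * (w - z)).
  rewrite /GRing.scale /= mulr1 subrK mulrBl [_^-1 * _]mulrC divfK //; ring.
by rewrite cmodN cmodM ler_wpM2r // cmod_ge0.
Qed.

Lemma cderiv_differentiable (f : R[i]^o -> R[i]^o) (z : R[i]^o) b :
  cderiv f z b -> differentiable f z.
Proof.
move=> H; apply/derivable1_diffP; apply/cvg_ex; exists b.
apply/cvgrPdist_le => e e0.
have /complex_realP[d de] : e \is Num.real by exact: gtr0_real.
have d0 : 0 < d by rewrite -ltcR -de.
have [d' d'0 K] := H _ d0.
rewrite near_withinE; apply: (cmod_nbhs d'0) => w; rewrite subr0 => wd w0.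
rewrite normr_cmod de lecR /GRing.scale /= mulr1.
have := K (w + z); rewrite addrK => /(_ wd) L.
rewrite -(ler_pM2r (_ : 0 < cmod w)) ?cmod_gt0 //.
rewrite -cmodM mulrBl mulrAC mulVf // mul1r -cmodN opprB //.
Qed.

End Differentiability.

(** * Integrals over segments and bisection of rectangles *)

Section SegmentIntegral.
Variable R : realType.
Implicit Types (f g : R -> R) (a b c : R).

Definition segint f a b := \int[lebesgue_measure]_(x in `[a, b]) f x.

Definition continuous_on_segment f a b :=
  forall x, a <= x <= b -> {for x, continuous f}.

Lemma continuous_on_segment_integrable f a b : continuous_on_segment f a b ->
  lebesgue_measure.-integrable `[a, b] (EFin \o f).
Proof.
move=> cf; apply: continuous_compact_integrable; first exact: segment_compact.
apply: continuous_in_subspaceT => x; rewrite inE /= in_itv /= => /cf; exact.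
Qed.

Lemma segint_split f a c b : a <= c <= b -> continuous_on_segment f a b ->
  segint f a b = segint f a c + segint f c b.
Proof.
move=> /andP[ac cb] cf; have fi := continuous_on_segment_integrable cf.
rewrite /segint.
have := @Rintegral_itvB R f (BLeft a) (BRight b) c fi.
rewrite !bnd_simp => /(_ ac cb).
rewrite Rintegral_itv_obnd_cbnd; last first.
  apply: integrableS fi => //; apply: subset_itvr; rewrite bnd_simp //.
by move=> <-; rewrite addrC subrK.
Qed.

(** The contributions of two opposite sides of a rectangle are compared through
    this lemma: there [f - g] is close to a constant although neither [f] nor
    [g] is. *)
Lemma segint_approx f g a b k e : a <= b ->
  continuous_on_segment f a b -> continuous_on_segment g a b ->
  (forall x, a <= x <= b -> `|f x - g x - k| <= e) ->
  `|segint f a b - segint g a b - k * (b - a)| <= e * (b - a).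
Proof.
move=> ab cf cg H.
have fi := continuous_on_segment_integrable cf.
have gi := continuous_on_segment_integrable cg.
have mab : measurable (`[a, b] : set (measurableTypeR R)) by [].
have ci (r : R) : lebesgue_measure.-integrable `[a, b] (EFin \o (fun=> r)).
  by apply: continuous_on_segment_integrable => x _; exact: cst_continuous.
have len : fine (lebesgue_measure (`[a, b] : set (measurableTypeR R))) = b - a.
  rewrite lebesgue_measure_itv /= lte_fin.
  by case: ltrgtP ab => // -> _; rewrite subrr.
have cst r : \int[lebesgue_measure]_(x in `[a, b]) (fun=> r) x = r * (b - a).
  by rewrite Rintegral_cst // len.
have fgi : lebesgue_measure.-integrable `[a, b] (EFin \o (f \- g)).
  have := integrableB mab fi gi; apply: eq_integrable => // x _.
rewrite /segint -RintegralB // ler_distl.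
rewrite (_ : k * (b - a) - e * (b - a) = (k - e) * (b - a)); last by ring.
rewrite (_ : k * (b - a) + e * (b - a) = (k + e) * (b - a)); last by ring.
rewrite -!cst; apply/andP; split; apply: le_Rintegral => // x /=; rewrite in_itv /= => /H;
  rewrite ler_distl => /andP[]; lra.
Qed.

Lemma segint_le f g a b : a <= b ->
  continuous_on_segment f a b -> continuous_on_segment g a b ->
  (forall x, a <= x <= b -> f x <= g x) -> segint f a b <= segint g a b.
Proof.
move=> ab cf cg H; apply: le_Rintegral; [by []| exact: continuous_on_segment_integrable | exact: continuous_on_segment_integrable|].
by move=> x /=; rewrite in_itv /= => /H.
Qed.

Lemma segint_cst r a b : a <= b -> segint (fun=> r) a b = r * (b - a).
Proof.
move=> ab; have c0 (s : R) : continuous_on_segment (fun=> s) a b.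
  by move=> x _; exact: cst_continuous.
have z0 : segint (fun=> 0 : R) a b = 0.
  by rewrite /segint Rintegral_cst // mul0r.
have := @segint_approx (fun=> r) (fun=> 0) a b r 0 ab (c0 r) (c0 0).
rewrite z0 mul0r !subr0 => H; apply/eqP; rewrite -subr_eq0 -normr_le0.
by apply: H => x _; rewrite subrr normr0.
Qed.

End SegmentIntegral.

Section Bisection.
Variable R : realType.

Lemma nested_segments (lo hi : nat -> R) :
  (forall n, lo n <= lo n.+1) -> (forall n, hi n.+1 <= hi n) ->
  (forall n, lo n <= hi n) -> exists c, forall n, lo n <= c <= hi n.
Proof.
move=> lo_up hi_down lohi.
have lo_le : {homo lo : m n / (m <= n)%N >-> m <= n}.
  by apply: homo_leq => //; exact: le_trans.
have hi_le : {homo hi : m n / (m <= n)%N >-> n <= m}.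
  by apply: homo_leq => // y x z xy yz; exact: le_trans yz xy.
have lh m n : lo m <= hi n.
  apply: le_trans (lo_le _ _ (leq_maxl m n)) _.
  exact: le_trans (lohi _) (hi_le _ _ (leq_maxr m n)).
exists (sup (range lo)) => n; apply/andP; split.
  apply: ub_le_sup; last by exists n.
  by exists (hi 0) => _ [m _ <-].
apply: ge_sup; first by exists (lo 0), 0.
by move=> _ [m _ <-].
Qed.

Lemma halving_small (A d : R) : 0 < d -> exists n0, forall n, (n0 <= n)%N -> A / 2 ^+ n < d.
Proof.
move=> d0; exists (Num.bound (`|A| / d)) => n n0n.
have p0 : 0 < 2 ^+ n :> R by rewrite exprn_gt0.
rewrite ltr_pdivrMr // mulrC -ltr_pdivrMr //.
apply: (@le_lt_trans _ _ (`|A| / d)).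
  by rewrite ler_pM2r ?invr_gt0 // ler_norm.
have := archi_boundP (_ : 0 <= `|A| / d) => /(_ _) /lt_le_trans; apply.
  by rewrite divr_ge0 // ltW.
rewrite -natrX ler_nat; apply: leq_trans n0n _.
by apply: ltnW; exact: ltn_expl.
Qed.

(** Compactness of the rectangle in the form of nested quarters: a failure of [P]
    on the rectangle would persist on some quarter at every generation, down to
    small rectangles around their common point.  [P x y k] concerns the dyadic
    subrectangle of generation [k] with lower left corner [(x, y)]. *)
Lemma rectangle_bisection (A B X Y : R) (P : R -> R -> nat -> Prop) :
  0 <= A -> 0 <= B ->
  (forall x y k,
    (forall x' y', x' \in [:: x; x + A / 2 ^+ k.+1] ->
       y' \in [:: y; y + B / 2 ^+ k.+1] -> P x' y' k.+1) -> P x y k) ->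
  (forall x0 y0, X <= x0 <= X + A -> Y <= y0 <= Y + B ->
     exists2 d : R, 0 < d & forall x y k, x <= x0 <= x + A / 2 ^+ k ->
       y <= y0 <= y + B / 2 ^+ k -> A / 2 ^+ k < d -> B / 2 ^+ k < d -> P x y k) ->
  P X Y 0.
Proof.
move=> A0 B0 quarters small; apply: contrapT => nP.
pose T := {p : R * R * nat | ~ P p.1.1 p.1.2 p.2}.
pose next (p q : T) := [/\ (sval q).2 = (sval p).2.+1,
  (sval q).1.1 \in [:: (sval p).1.1; (sval p).1.1 + A / 2 ^+ (sval p).2.+1] &
  (sval q).1.2 \in [:: (sval p).1.2; (sval p).1.2 + B / 2 ^+ (sval p).2.+1]].
have step p : {q : T | next p q}.
  apply: cid; case: p => -[[x y] k] /= nPk; apply: contrapT => H; apply: (nPk).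
  apply: quarters => x' y' hx hy; apply: contrapT => nP'; apply: H.
  by exists (exist _ (x', y', k.+1) nP').
have [f [f0 fS]] := dependent_choice step (exist _ (X, Y, 0%N) nP).
pose x n := (sval (f n)).1.1; pose y n := (sval (f n)).1.2.
have fk n : (sval (f n)).2 = n.
  by elim: n => [|n IH]; [rewrite f0 | case: (fS n) => -> _ _; rewrite IH].
have half (C : R) n : C / 2 ^+ n = C / 2 ^+ n.+1 + C / 2 ^+ n.+1.
  by rewrite exprS; field; rewrite expf_neq0.
have nest (C : R) (z : nat -> R) : 0 <= C ->
    (forall n, z n.+1 \in [:: z n; z n + C / 2 ^+ n.+1]) ->
    exists c, forall n, z n <= c <= z n + C / 2 ^+ n.
  move=> C0 zS; apply: nested_segments => n.
  - have := zS n; rewrite !inE => /orP[] /eqP -> //.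
    by rewrite lerDl divr_ge0 // exprn_ge0.
  - have h0 : 0 <= C / 2 ^+ n.+1 by rewrite divr_ge0 // exprn_ge0.
    by have := zS n; rewrite !inE (half C n) => /orP[] /eqP ->; lra.
  - by rewrite lerDl divr_ge0 // exprn_ge0.
have [x0 hx0] : exists c, forall n, x n <= c <= x n + A / 2 ^+ n.
  by apply: nest => // n; case: (fS n) => _; rewrite fk.
have [y0 hy0] : exists c, forall n, y n <= c <= y n + B / 2 ^+ n.
  by apply: nest => // n; case: (fS n) => _ _; rewrite fk.
have [||d d0 H] := small x0 y0.
- by have := hx0 0%N; rewrite /x f0 /= expr0 divr1.
- by have := hy0 0%N; rewrite /y f0 /= expr0 divr1.
have [n1 h1] := halving_small A d0; have [n2 h2] := halving_small B d0.
have := H (x (maxn n1 n2)) (y (maxn n1 n2)) (maxn n1 n2) (hx0 _) (hy0 _).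
rewrite h1 ?leq_maxl // h2 ?leq_maxr // => /(_ isT isT).
rewrite -{3}(fk (maxn n1 n2)); exact: (svalP (f (maxn n1 n2))).
Qed.

End Bisection.

(** * Goursat's theorem on rectangles *)

Section Goursat.
Variable R : realType.
Implicit Types (F : R -> R -> R[i]) (x y : R).

(** Complex differentiability of [x + iy -> F x y], in the coordinates used for
    integration. *)
Definition plane_cderiv F x0 y0 (b : R[i]) :=
  forall e : R, 0 < e -> exists2 d : R, 0 < d & forall x y,
    `|x - x0| < d -> `|y - y0| < d ->
    cmod (F x y - F x0 y0 - b * Complex (x - x0) (y - y0))
      <= e * (`|x - x0| + `|y - y0|).

Definition plane_holomorphic F x1 x2 y1 y2 := forall x y,
  x1 <= x <= x2 -> y1 <= y <= y2 -> exists b, plane_cderiv F x y b.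

Lemma plane_cderiv_continuous F x0 y0 b (e : R) : plane_cderiv F x0 y0 b ->
  0 < e -> exists2 d : R, 0 < d & forall x y,
    `|x - x0| < d -> `|y - y0| < d -> cmod (F x y - F x0 y0) <= e.
Proof.
move=> dF e0; have [d d0 H] := dF 1 ltr01.
pose K := 2 * (1 + cmod b); have K0 : 0 < K by have := cmod_ge0 b; rewrite /K; lra.
exists (Num.min d (e / K)); first by rewrite lt_min d0 divr_gt0.
move=> x y; rewrite !lt_min => /andP[xd xe] /andP[yd ye].
have {H} := H _ _ xd yd.
set D := F x y - F x0 y0; set w := Complex _ _ => H.
have hw : cmod w <= `|x - x0| + `|y - y0| by exact: cmod_le_ReIm.
have hD : cmod D <= cmod (D - b * w) + cmod b * cmod w.
  by rewrite -cmodM; have := cmodD (D - b * w) (b * w); rewrite subrK.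
have xK : `|x - x0| * K < e by rewrite -ltr_pdivlMr.
have yK : `|y - y0| * K < e by rewrite -ltr_pdivlMr.
have bw : cmod b * cmod w <= cmod b * (`|x - x0| + `|y - y0|).
  by rewrite ler_wpM2l // cmod_ge0.
by apply: le_trans hD _; rewrite /K in xK yK; lra.
Qed.

Lemma continuous_ReF F x1 x2 y1 y2 : plane_holomorphic F x1 x2 y1 y2 ->
  [/\ forall x, x1 <= x <= x2 -> continuous_on_segment (fun y => Re (F x y)) y1 y2
   & forall y, y1 <= y <= y2 -> continuous_on_segment (fun x => Im (F x y)) x1 x2].
Proof.
move=> hF; split=> [x hx y hy|y hy x hx]; apply/cvgrPdist_le => e e0;
  have [b dF] := hF x y hx hy; have [d d0 H] := plane_cderiv_continuous dF e0;
  apply/nbhs_ballP; exists d => // t; rewrite /ball /= distrC => td;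
  rewrite -raddfB.
- have := H x t; rewrite subrr normr0 => /(_ d0 td); apply: le_trans.
  by rewrite -opprB raddfN normrN /=; exact: normRe_le_cmod.
- have := H t y td; rewrite subrr normr0 => /(_ d0); apply: le_trans.
  by rewrite -opprB raddfN normrN /=; exact: Im_le_cmod.
Qed.

(** The imaginary part of the contour integral of [F] along the boundary of a
    rectangle.  The imaginary part alone suffices, because only the real part of
    the mean of [F] over a vertical side is needed. *)
Definition circulation F x1 x2 y1 y2 :=
  (segint (fun y => Re (F x2 y)) y1 y2 - segint (fun y => Re (F x1 y)) y1 y2)
  - (segint (fun x => Im (F x y2)) x1 x2 - segint (fun x => Im (F x y1)) x1 x2).

Lemma plane_holomorphicS F x1 x2 y1 y2 x1' x2' y1' y2' :
  plane_holomorphic F x1 x2 y1 y2 -> x1 <= x1' -> x2' <= x2 -> y1 <= y1' ->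
  y2' <= y2 -> plane_holomorphic F x1' x2' y1' y2'.
Proof. by move=> hF ? ? ? ? x y ? ?; apply: hF; lra. Qed.

Lemma circulation_split F x1 x x2 y1 y y2 : plane_holomorphic F x1 x2 y1 y2 ->
  x1 <= x <= x2 -> y1 <= y <= y2 ->
  circulation F x1 x2 y1 y2 =
    circulation F x1 x y1 y + circulation F x x2 y1 y
    + circulation F x1 x y y2 + circulation F x x2 y y2.
Proof.
move=> /continuous_ReF [cRe cIm] hx hy; rewrite /circulation.
have sRe t : x1 <= t <= x2 -> segint (fun y => Re (F t y)) y1 y2 =
    segint (fun y => Re (F t y)) y1 y + segint (fun y => Re (F t y)) y y2.
  by move=> ht; apply: segint_split => //; exact: cRe.
have sIm t : y1 <= t <= y2 -> segint (fun x => Im (F x t)) x1 x2 =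
    segint (fun x => Im (F x t)) x1 x + segint (fun x => Im (F x t)) x x2.
  by move=> ht; apply: segint_split => //; exact: cIm.
have [x1x xx2] := andP hx; have [y1y yy2] := andP hy.
have x12 := le_trans x1x xx2; have y12 := le_trans y1y yy2.
rewrite !sRe ?sIm ?lexx ?x12 ?y12 ?hx ?hy //; ring.
Qed.

(** Around a point where [F] is complex differentiable the circulation is small
    compared to the square of the diameter: the affine part of [F] contributes
    [Re b * A * B] to both brackets. *)
Lemma circulation_small F x0 y0 b (e : R) : plane_cderiv F x0 y0 b -> 0 < e ->
  exists2 d : R, 0 < d & forall x y A B,
    x <= x0 <= x + A -> y <= y0 <= y + B -> A < d -> B < d ->
    plane_holomorphic F x (x + A) y (y + B) ->
    `|circulation F x (x + A) y (y + B)| <= e * (A + B) ^+ 2.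
Proof.
move=> dF e0; have [|d d0 H] := dF (e / 2); first by rewrite divr_gt0.
exists d => // x y A B hx hy Ad Bd /continuous_ReF [cRe cIm].
have est s t : x <= s <= x + A -> y <= t <= y + B ->
    cmod (F s t - F x0 y0 - b * Complex (s - x0) (t - y0)) <= e / 2 * (A + B).
  move=> hs ht.
  have hsA : `|s - x0| <= A by rewrite ler_norml; lra.
  have htB : `|t - y0| <= B by rewrite ler_norml; lra.
  apply: le_trans (H s t _ _) _; [lra|lra|].
  by rewrite ler_wpM2l ?lerD //; lra.
have vert : `|segint (fun t => Re (F (x + A) t)) y (y + B) -
   segint (fun t => Re (F x t)) y (y + B) - Re b * A * B| <= e * (A + B) * B.
  have := @segint_approx R (fun t => Re (F (x + A) t)) (fun t => Re (F x t))
    y (y + B) (Re b * A) (e * (A + B)).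
  rewrite (_ : y + B - y = B); last by ring.
  apply; [lra|apply: cRe; lra|apply: cRe; lra|].
  move=> t ht; have hA : x <= x + A <= x + A by lra.
  have hA' : x <= x <= x + A by lra.
  have E1 := le_trans (normRe_le_cmod _) (est _ _ hA ht).
  have E2 := le_trans (normRe_le_cmod _) (est _ _ hA' ht).
  move: E1 E2; case: (b) => br bi; case: (F (x + A) t) => u1 v1.
  case: (F x t) => u2 v2; case: (F x0 y0) => u3 v3 /=.
  by rewrite !ler_norml => /andP[? ?] /andP[? ?]; lra.
have hori : `|segint (fun s => Im (F s (y + B))) x (x + A) -
   segint (fun s => Im (F s y)) x (x + A) - Re b * B * A| <= e * (A + B) * A.
  have := @segint_approx R (fun s => Im (F s (y + B))) (fun s => Im (F s y))
    x (x + A) (Re b * B) (e * (A + B)).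
  rewrite (_ : x + A - x = A); last by ring.
  apply; [lra|apply: cIm; lra|apply: cIm; lra|].
  move=> s hs; have hB : y <= y + B <= y + B by lra.
  have hB' : y <= y <= y + B by lra.
  have E1 := le_trans (Im_le_cmod _) (est _ _ hs hB).
  have E2 := le_trans (Im_le_cmod _) (est _ _ hs hB').
  move: E1 E2; case: (b) => br bi; case: (F s (y + B)) => u1 v1.
  case: (F s y) => u2 v2; case: (F x0 y0) => u3 v3 /=.
  by rewrite !ler_norml => /andP[? ?] /andP[? ?]; lra.
move: vert hori; rewrite /circulation !ler_norml => /andP[? ?] /andP[? ?].
by rewrite expr2; apply/andP; split; lra.
Qed.

(** The circulation is additive over the four quarters of a rectangle, so the
    bound [e / 4 ^ k] at generation [k] follows from the bounds [e / 4 ^ k.+1]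
    at the next one; and around each point it holds for small rectangles by
    [circulation_small], whatever the constant [e]. *)
Theorem goursat_rectangle F x1 x2 y1 y2 : x1 <= x2 -> y1 <= y2 ->
  plane_holomorphic F x1 x2 y1 y2 -> circulation F x1 x2 y1 y2 = 0.
Proof.
move=> x12 y12 hF; pose A := x2 - x1; pose B := y2 - y1.
have A0 : 0 <= A by rewrite subr_ge0.
have B0 : 0 <= B by rewrite subr_ge0.
suff small e : 0 < e -> `|circulation F x1 x2 y1 y2| <= e.
  apply/eqP; rewrite -normr_le0; apply/ler_addgt0Pr => e e0.
  by rewrite add0r; exact: small.
move=> e0.
(* so that e' times the square of the half-perimeter stays below e *)
pose e' := e / (1 + (A + B) ^+ 2).
have s0 : 0 < 1 + (A + B) ^+ 2 by rewrite ltr_pwDl ?sqr_ge0.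
have e'0 : 0 < e' by rewrite divr_gt0.
pose P x y (k : nat) := x1 <= x -> y1 <= y -> x + A / 2 ^+ k <= x2 ->
  y + B / 2 ^+ k <= y2 ->
  `|circulation F x (x + A / 2 ^+ k) y (y + B / 2 ^+ k)| <= e / 4 ^+ k.
have : P x1 y1 0%N.
  apply: (@rectangle_bisection R A B x1 y1 P A0 B0) => [x y k quarters|x0 y0 hx0 hy0].
  - have half (C : R) : C / 2 ^+ k = C / 2 ^+ k.+1 + C / 2 ^+ k.+1.
      by rewrite exprS; field; rewrite expf_neq0.
    rewrite /P 2!half => hx hy hx2 hy2.
    have hA : 0 <= A / 2 ^+ k.+1 by rewrite divr_ge0 // exprn_ge0.
    have hB : 0 <= B / 2 ^+ k.+1 by rewrite divr_ge0 // exprn_ge0.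
    move: quarters hA hB hx2 hy2; rewrite /P.
    set a := A / 2 ^+ k.+1; set b := B / 2 ^+ k.+1 => quarters hA hB.
    rewrite (addrA x a a) (addrA y b b) => hx2 hy2.
    have xa : x1 <= x + a by rewrite (le_trans hx) // lerDl.
    have yb : y1 <= y + b by rewrite (le_trans hy) // lerDl.
    have xa2 : x + a <= x2 by rewrite (le_trans _ hx2) // lerDl.
    have yb2 : y + b <= y2 by rewrite (le_trans _ hy2) // lerDl.
    have -> : e / 4 ^+ k = 4 * (e / 4 ^+ k.+1).
      by rewrite exprS; field; rewrite expf_neq0.
    rewrite (@circulation_split F x (x + a) _ y (y + b)); [|exact: plane_holomorphicS hF _ _ _ _
      |by rewrite !lerDl hA|by rewrite !lerDl hB].
    have ix : x \in [:: x; x + a] by rewrite !inE eqxx.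
    have ix' : x + a \in [:: x; x + a] by rewrite !inE eqxx orbT.
    have iy : y \in [:: y; y + b] by rewrite !inE eqxx.
    have iy' : y + b \in [:: y; y + b] by rewrite !inE eqxx orbT.
    have q1 := quarters _ _ ix iy; have q2 := quarters _ _ ix' iy.
    have q3 := quarters _ _ ix iy'; have q4 := quarters _ _ ix' iy'.
    have {}q1 := q1 hx hy xa2 yb2.
    have {}q2 := q2 xa hy hx2 yb2.
    have {}q3 := q3 hx yb xa2 hy2.
    have {}q4 := q4 xa yb hx2 hy2.
    move: q1 q2 q3 q4; clear; rewrite !ler_norml.
    move=> /andP[? ?] /andP[? ?] /andP[? ?] /andP[? ?]. lra.
  - have [b dF] := hF x0 y0 ltac:(rewrite /A in hx0; lra) ltac:(rewrite /B in hy0; lra).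
    have [d d0 H] := circulation_small dF e'0.
    exists d => // x y k hx hy Ad Bd hx1 hy1 hx2 hy2.
    apply: le_trans (H _ _ _ _ hx hy Ad Bd _) _.
      by apply: plane_holomorphicS hF _ _ _ _ => //; lra.
    rewrite -mulrDl expr_div_n -exprM mulnC exprM.
    rewrite (_ : 2 ^+ 2 = 4); last by rewrite -natrX.
    rewrite mulrA ler_pM2r ?invr_gt0 ?exprn_gt0 // /e' mulrAC ler_pdivrMr //.
    by rewrite ler_pM2l //; lra.
rewrite /P !expr0 !divr1 /A /B !(addrC x1) !(addrC y1) !subrK; apply => //.
Qed.

End Goursat.

(** * The maximum principle at the centre of the disc *)

Section PolarCoordinates.
Variable R : realType.
Implicit Types (x y : R).

Definition cexp x y : R[i] := Complex (expR x * cos y) (expR x * sin y).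

Lemma cexpD x x' y y' : cexp (x + x') (y + y') = cexp x y * cexp x' y'.
Proof.
rewrite /cexp expRD cosD sinD; apply/eqP; rewrite eq_complex /=.
by apply/andP; split; apply/eqP; ring.
Qed.

Lemma cmod_cexp x y : cmod (cexp x y) = expR x.
Proof.
rewrite /cmod /= !exprMn -mulrDr cos2Dsin2 mulr1 sqrtr_sqr.
by rewrite ger0_norm // expR_ge0.
Qed.

Lemma is_derive_estimate (f : R -> R) (a l e : R) : is_derive a 1 f l -> 0 < e ->
  exists2 d : R, 0 < d & forall t, `|t| < d -> `|f (a + t) - f a - l * t| <= e * `|t|.
Proof.
move=> [df <-] e0; have /cvgrPdist_le/(_ _ e0) := df.
rewrite -/('D_1 f a).
rewrite near_withinE => /nbhs_ballP[d /= d0 H]; exists d => // t td.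
have [->|t0] := eqVneq t 0; first by rewrite addr0 mulr0 subrr subr0 normr0 mulr0.
have := H t; rewrite /ball /= sub0r normrN => /(_ td t0).
rewrite -(ler_pM2r (_ : 0 < `|t|)) ?normr_gt0 // -normrM distrC.
rewrite /GRing.scale /= mulr1 (addrC t a) mulrBl mulrAC mulVf // mul1r.
by [].
Qed.

Lemma cexp_plane_cderiv0 : plane_cderiv cexp 0 0 1.
Proof.
move=> e e0.
pose e' := Num.min 1 (e / 8).
have e'0 : 0 < e' by rewrite lt_min ltr01 divr_gt0.
have [e'1 e'e] : e' <= 1 /\ e' <= e / 8 by split; rewrite ge_min lexx ?orbT.
clearbody e'.
have [d1 d10 H1] := is_derive_estimate (is_derive_expR (0 : R)) e'0.
have [d2 d20 H2] := is_derive_estimate (is_derive_cos (0 : R)) e'0.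
have [d3 d30 H3] := is_derive_estimate (is_derive_sin (0 : R)) e'0.
exists (Num.min e' (Num.min d1 (Num.min d2 d3))); first by rewrite !lt_min e'0 d10 d20.
move=> x y; rewrite !subr0 !lt_min.
move=> /and4P[xe x1 _ _] /and4P[ye _ y2 y3].
have := H1 _ x1; have := H2 _ y2; have := H3 _ y3.
rewrite !add0r expR0 cos0 sin0 oppr0 mul0r !mul1r !subr0 ?addr0 => h3 h2 h1.
apply: le_trans (cmod_le_ReIm _) _; rewrite /cexp /= expR0 cos0 sin0.
rewrite !mul1r subr0.
set E := expR x in h1 *; set C := cos y in h2 *; set S := sin y in h3 *.
have E2 : `|E| <= 3.
  have := ler_normD (E - 1 - x) (1 + x); rewrite (_ : E - 1 - x + (1 + x) = E); last by ring.
  have := ler_normD 1 x; rewrite normr1.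
  have := ler_wpM2r (normr_ge0 x) e'1; lra.
have E1 : `|E - 1| <= 2 * e'.
  have := ler_normD (E - 1 - x) x; rewrite subrK.
  have := ler_wpM2r (normr_ge0 x) e'1; lra.
have S2 : `|S| <= 2 * `|y|.
  have := ler_normD (S - y) y; rewrite subrK.
  have := ler_wpM2r (normr_ge0 y) e'1; lra.
have re : `|E * C - 1 - x| <= e' * `|x| + 3 * (e' * `|y|).
  rewrite (_ : E * C - 1 - x = (E - 1 - x) + E * (C - 1)); last by ring.
  by apply: le_trans (ler_normD _ _) _; rewrite normrM lerD // ler_pM.
have im : `|E * S - y| <= 2 * e' * (2 * `|y|) + e' * `|y|.
  rewrite (_ : E * S - y = (E - 1) * S + (S - y)); last by ring.
  by apply: le_trans (ler_normD _ _) _; rewrite normrM lerD // ler_pM.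
have := ler_wpM2r (normr_ge0 x) e'e; have := ler_wpM2r (normr_ge0 y) e'e.
have ? := normr_ge0 x; have ? := normr_ge0 y; have : 0 <= e * `|x| by rewrite mulr_ge0 // ltW.
by lra.
Qed.

(** By the functional equation the derivative at the origin determines all. *)
Lemma cexp_plane_cderiv x0 y0 : plane_cderiv cexp x0 y0 (cexp x0 y0).
Proof.
move=> e e0; have K0 : 0 < cmod (cexp x0 y0) by rewrite cmod_cexp expR_gt0.
have [|d d0 H] := cexp_plane_cderiv0 (_ : 0 < e / cmod (cexp x0 y0)).
  by rewrite divr_gt0.
exists d => // x y hx hy.
have := H (x - x0) (y - y0); rewrite !subr0 => /(_ hx hy).
rewrite mul1r -(ler_pM2l K0) -cmodM !mulrBr -!cexpD !addr0.
by rewrite 2![_ + (_ - _)]addrC !subrK mulrA [_ * (e / _)]mulrC divfK ?gt_eqF.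
Qed.

Lemma plane_cderiv_comp (h : R[i] -> R[i]) (F : R -> R -> R[i]) x0 y0 c b :
  cderiv h (F x0 y0) c -> plane_cderiv F x0 y0 b ->
  plane_cderiv (fun x y => h (F x y)) x0 y0 (c * b).
Proof.
move=> dh dF e e0.
have b0 := cmod_ge0 b; have c0 := cmod_ge0 c.
have [|d1 d10 H1] := dh (e / (2 * (1 + cmod b))); first by rewrite divr_gt0 //; lra.
have [|d2 d20 H2] := dF (Num.min 1 (e / (2 * (1 + cmod c)))).
  by rewrite lt_min ltr01 divr_gt0 //; lra.
have [|d3 d30 H3] := plane_cderiv_continuous dF (_ : 0 < d1 / 2); first by rewrite divr_gt0.
exists (Num.min d2 d3); first by rewrite lt_min d20.
move=> x y; rewrite !lt_min => /andP[x2 x3] /andP[y2 y3].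
have {H3} h3 := H3 _ _ x3 y3; have {H2} h2 := H2 _ _ x2 y2.
have {H1} h1 := H1 (F x y) ltac:(lra).
set w := Complex _ _ in h2 *; set D := F x y - F x0 y0 in h1 h2 *.
set rho := `|x - x0| + `|y - y0| in h2 *.
have rho0 : 0 <= rho by rewrite addr_ge0.
have hw : cmod w <= rho by exact: cmod_le_ReIm.
have h21 : cmod (D - b * w) <= rho.
  by apply: le_trans h2 _; rewrite -[leRHS]mul1r ler_wpM2r // ge_min lexx.
have h22 : cmod (D - b * w) <= e / (2 * (1 + cmod c)) * rho.
  by apply: le_trans h2 _; rewrite ler_wpM2r // ge_min lexx orbT.
have hD : cmod D <= (1 + cmod b) * rho.
  have := cmodD (D - b * w) (b * w); rewrite subrK cmodM.
  have := ler_wpM2l b0 hw; lra.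
rewrite (_ : _ - _ = (h (F x y) - h (F x0 y0) - c * D) + c * (D - b * w)); last by ring.
apply: le_trans (cmodD _ _) _; rewrite cmodM.
have k1 : e / (2 * (1 + cmod b)) * cmod D <= e / 2 * rho.
  rewrite invfM mulrA -!mulrA ler_pM2l // ler_pM2l ?invr_gt0 //.
  by rewrite ler_pdivrMl //; lra.
have k2 : cmod c * cmod (D - b * w) <= e / 2 * rho.
  apply: (@le_trans _ _ ((1 + cmod c) * (e / (2 * (1 + cmod c)) * rho))).
    by apply: ler_pM => //; [exact: cmod_ge0 | lra].
  rewrite (_ : _ * _ = e / 2 * rho) //; field; lra.
lra.
Qed.

(** The half-plane [x < 0] covers the punctured disc, periodically in [y]: on a
    rectangle of height [2 pi] the horizontal sides cancel, so the mean of
    [Re h] over a circle does not depend on the radius, and it tends to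
    [Re (h 0)] as the radius shrinks. *)
Lemma Re_center_le (h : R[i] -> R[i]) (r M : R) : 0 < r < 1 ->
  (forall z, cmod z < 1 -> exists b, cderiv h z b) ->
  (forall z, cmod z = r -> Re (h z) <= M) -> Re (h 0) <= M.
Proof.
move=> /andP[r0 r1] dh hM; apply/ler_addgt0Pr => e e0.
have [b0 db0] : exists b, cderiv h 0 b by apply: dh; rewrite cmod0.
have K0 : 0 < 1 + cmod b0 by rewrite ltr_pwDl // cmod_ge0.
have [d d0 Hd] := db0 1 ltr01.
have s0 : 0 < Num.min (Num.min d r) (e / (1 + cmod b0)).
  by rewrite !lt_min d0 r0 divr_gt0.
(* small enough for h to be within e of h 0 on the circle of radius exp x1 *)
pose x1 := ln (Num.min (Num.min d r) (e / (1 + cmod b0)) / 2).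
pose x2 := ln r.
have Ex1 : expR x1 = Num.min (Num.min d r) (e / (1 + cmod b0)) / 2.
  by rewrite lnK // posrE divr_gt0.
have Ex2 : expR x2 = r by rewrite lnK.
have [Ed Er Ee] : [/\ expR x1 < d, expR x1 < r & expR x1 < e / (1 + cmod b0)].
  have lt_half (t : R) : Num.min (Num.min d r) (e / (1 + cmod b0)) <= t -> expR x1 < t.
    by rewrite Ex1; move: s0; clear; lra.
  by split; apply: lt_half; rewrite !ge_min lexx ?orbT.
have x12 : x1 <= x2 by rewrite -ler_expR Ex2 ltW.
pose F x y := h (cexp x y).
have pi0 : 0 <= 2 * pi :> R by rewrite mulr_ge0 // pi_ge0.
have hF : plane_holomorphic F x1 x2 0 (2 * pi).
  move=> x y hx hy.
  have [|c dc] := dh (cexp x y).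
    rewrite cmod_cexp; apply: le_lt_trans r1; rewrite -Ex2 ler_expR; lra.
  by exists (c * cexp x y); apply: plane_cderiv_comp dc (cexp_plane_cderiv x y).
have := goursat_rectangle x12 pi0 hF.
have per x : F x (2 * pi) = F x 0.
  by rewrite /F /cexp mulr_natl cos2pi sin2pi cos0 sin0.
rewrite /circulation (_ : (fun x => Im (F x (2 * pi))) = (fun x => Im (F x 0))); last first.
  by apply/funext => x; rewrite per.
rewrite subrr subr0 => /subr0_eq means.
have [cRe _] := continuous_ReF hF.
have c0 (s : R) : continuous_on_segment (fun=> s) 0 (2 * pi).
  by move=> x _; exact: cst_continuous.
have up : segint (fun y => Re (F x2 y)) 0 (2 * pi) <= M * (2 * pi - 0).
  rewrite -(segint_cst M pi0); apply: segint_le; [by []|by apply: cRe; rewrite x12 lexx|exact: c0|].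
  by move=> y _; apply: hM; rewrite cmod_cexp.
have low : (Re (h 0) - e) * (2 * pi - 0) <= segint (fun y => Re (F x1 y)) 0 (2 * pi).
  rewrite -(segint_cst _ pi0); apply: segint_le; [by []|exact: c0|by apply: cRe; rewrite x12 lexx|].
  move=> y _; have := Hd (cexp x1 y); rewrite subr0 cmod_cexp mul1r => /(_ Ed) H.
  have := cmodD (F x1 y - h 0 - b0 * cexp x1 y) (b0 * cexp x1 y).
  rewrite subrK cmodM cmod_cexp.
  have := le_trans (ler_norm _) (normRe_le_cmod (h 0 - F x1 y)); rewrite cmodB raddfB /=.
  move: Ee H; rewrite ltr_pdivlMr // -/(F x1 y); clear; lra.
rewrite -lerBlDr -(@ler_pM2r _ (2 * pi - 0)); last by rewrite subr0 mulr_gt0 // pi_gt0.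
by apply: le_trans low _; rewrite -means.
Qed.

(** A rotation makes [h 0] real and nonnegative. *)
Lemma cmod_center_le (h : R[i] -> R[i]) (r M : R) : 0 < r < 1 ->
  (forall z, cmod z < 1 -> exists b, cderiv h z b) ->
  (forall z, cmod z = r -> cmod (h z) <= M) -> cmod (h 0) <= M.
Proof.
move=> hr dh hM; have [w w1 hw] := polar_form (h 0).
have -> : cmod (h 0) = Re (w^* * h 0).
  by rewrite {2}hw mulrA (mulrC _ w) mul_conj w1 expr1n mul1r.
apply: (@Re_center_le (fun z => w^* * h z) r) => // [z z1|z zr]; last first.
  apply: le_trans (Re_le_cmod _) _; rewrite cmodM cmod_conj w1 mul1r; exact: hM.
have [b db] := dh z z1; exists (w^* * b) => e e0; have [d d0 H] := db e e0.
exists d => // u ud; rewrite -mulrBr -mulrA -mulrBr cmodM cmod_conj w1 mul1r.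
exact: H.
Qed.

End PolarCoordinates.

(** * The Schwarz-Pick lemma *)

Section Moebius.
Variable R : realType.
Implicit Types (a z : R[i]).

Definition moebius a z := (z - a) / (1 - a^* * z).

Lemma rho_moebius a z : rho z a = atanh (cmod (moebius a z)).
Proof. by []. Qed.

Lemma moebius_modulus a z :
  cmod (1 - a^* * z) ^+ 2 - cmod (z - a) ^+ 2
    = (1 - cmod a ^+ 2) * (1 - cmod z ^+ 2).
Proof. by rewrite !cmod_sq; case: a z => [? ?] [? ?] /=; ring. Qed.

Lemma moebius_denominator_ge a z : cmod z <= 1 -> 1 - cmod a <= cmod (1 - a^* * z).
Proof.
move=> z1; apply: le_trans (ler_cmodB _ _).
by rewrite cmod1 cmodM cmod_conj lerB // ler_piMr // cmod_ge0.
Qed.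

Lemma moebius_denominator_neq0 a z : cmod a < 1 -> cmod z <= 1 -> 1 - a^* * z != 0.
Proof. by move=> a1 z1; rewrite -cmod_gt0; have := moebius_denominator_ge a z1; lra. Qed.

Lemma cmod_moebius_sq a z : cmod a < 1 -> cmod z <= 1 ->
  1 - cmod (moebius a z) ^+ 2
    = (1 - cmod a ^+ 2) * (1 - cmod z ^+ 2) / cmod (1 - a^* * z) ^+ 2.
Proof.
move=> a1 z1; rewrite -moebius_modulus cmodM cmodV exprMn exprVn.
by rewrite mulrBl divff // expf_neq0 // cmod_eq0 moebius_denominator_neq0.
Qed.

Lemma cmod_moebius_lt1 a z : cmod a < 1 -> cmod z < 1 -> cmod (moebius a z) < 1.
Proof.
move=> a1 z1; rewrite -(@expr_lt1 _ 2) ?cmod_ge0 // -subr_gt0.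
rewrite cmod_moebius_sq // ?ltW //; apply: divr_gt0.
  by rewrite mulr_gt0 // subr_gt0 cmod_sqr_lt1.
by rewrite exprn_gt0 // cmod_gt0 moebius_denominator_neq0 // ltW.
Qed.

Lemma moebiusNK a z : cmod a < 1 -> cmod z < 1 -> moebius (- a) (moebius a z) = z.
Proof.
move=> a1 z1; have d0 := moebius_denominator_neq0 a1 (ltW z1).
have aa : 1 - a * a^* != 0.
  by rewrite mulrC moebius_denominator_neq0 // ltW.
rewrite /moebius rmorphN; field.
apply/andP; split => //; rewrite (_ : _ + _ = 1 - a * a^*) //; ring.
Qed.

Lemma moebiusvv a : moebius a a = 0.
Proof. by rewrite /moebius subrr mul0r. Qed.

Lemma moebiusN0 a : moebius (- a) 0 = a.
Proof. by rewrite /moebius mulr0 subr0 divr1 opprK add0r. Qed.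

Lemma differentiable_moebius a (z : R[i]^o) : cmod a < 1 -> cmod z < 1 ->
  differentiable (moebius a : R[i]^o -> R[i]^o) z.
Proof.
move=> a1 z1; apply: differentiable_mul.
  by apply: differentiable_sub; [by []|exact: differentiable_cst].
apply: differentiable_inv; last by rewrite moebius_denominator_neq0 // ltW.
apply: differentiable_sub; first exact: differentiable_cst.
by apply: differentiable_mul; [exact: differentiable_cst|by []].
Qed.

Lemma holo_moebius a : cmod a < 1 -> holo (unit_disc R) (unit_disc R) (moebius a).
Proof.
move=> a1 z z1; split; first exact: differentiable_moebius.
exact: cmod_moebius_lt1.
Qed.

Lemma holo_comp (U V W : normedModType R[i]) (X : set U) (Y : set V) (Z : set W) f g :
  holo X Y f -> holo Y Z g -> holo X Z (g \o f).
Proof.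
move=> hf hg z Xz; have [df Yf] := hf z Xz; have [dg Zg] := hg _ Yf.
by split=> //; apply: differentiable_comp.
Qed.

End Moebius.

Section SchwarzPick.
Variable R : realType.

(** A factor that is merely continuous is enough when the other one vanishes; it
    is applied below to a power of [f z / z], continued at [0] by its limit. *)
Lemma cderiv_mul_zero (f G : R[i]^o -> R[i]^o) b : f 0 = 0 -> cderiv f 0 b ->
  {for 0, continuous G} -> cderiv (fun z => f z * G z) 0 (b * G 0).
Proof.
move=> f0 df cG e e0; have b0 := cmod_ge0 b; have g0 := cmod_ge0 (G 0).
pose e1 := Num.min 1 (e / (2 * (1 + cmod b))).
have e10 : 0 < e1 by rewrite lt_min ltr01 divr_gt0 //; lra.
have [|d1 d10 H1] := df (e / (2 * (1 + cmod (G 0)))); first by rewrite divr_gt0 //; lra.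
have [|d2 d20 H2] := @nbhs_cmod R 0 (fun w => cmod (G w - G 0) <= e1).
  have /cvgrPdist_le /(_ (e1%:C)%C) := cG.
  by rewrite ltcR => /(_ e10); apply: filterS => w; rewrite normr_cmod lecR cmodB.
exists (Num.min d1 d2); first by rewrite lt_min d10.
move=> w; rewrite !subr0 lt_min => /andP[w1 w2].
have := H1 w; rewrite !subr0 f0 subr0 => /(_ w1) h1.
have := H2 w; rewrite subr0 => /(_ w2) h2.
have [h21 h22] : cmod (G w - G 0) <= 1 /\ cmod (G w - G 0) <= e / (2 * (1 + cmod b)).
  by split; apply: le_trans h2 _; rewrite /e1 ge_min lexx ?orbT.
have gw : cmod (G w) <= 1 + cmod (G 0).
  by have := cmodD (G w - G 0) (G 0); rewrite subrK; lra.
rewrite mul0r subr0 (_ : _ - _ = (f w - b * w) * G w + b * (G w - G 0) * w); last by ring.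
apply: le_trans (cmodD _ _) _; rewrite !cmodM.
have w0 := cmod_ge0 w.
have k1 : cmod (f w - b * w) * cmod (G w) <= e / 2 * cmod w.
  apply: (@le_trans _ _ (e / (2 * (1 + cmod (G 0))) * cmod w * (1 + cmod (G 0)))).
    by apply: ler_pM => //; exact: cmod_ge0.
  rewrite le_eqVlt; apply/orP; left; apply/eqP; field; rewrite gt_eqF //; lra.
have k2 : cmod b * cmod (G w - G 0) * cmod w <= e / 2 * cmod w.
  rewrite ler_wpM2r //.
  apply: (@le_trans _ _ ((1 + cmod b) * (e / (2 * (1 + cmod b))))).
    by apply: ler_pM => //; [exact: cmod_ge0| lra].
  rewrite le_eqVlt; apply/orP; left; apply/eqP; field; rewrite gt_eqF //; lra.
lra.
Qed.

Lemma bounded_powers_le1 (x c : R) : 0 <= x -> 0 < c ->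
  (forall N, x ^+ N * c <= 1) -> x <= 1.
Proof.
move=> x0 c0 H; rewrite leNgt; apply/negP => x1.
have d0 : 0 < x - 1 by rewrite subr_gt0.
have bern n : 1 + n%:R * (x - 1) <= x ^+ n.
  elim: n => [|n IH]; first by rewrite mul0r addr0 expr0.
  rewrite exprS -natr1; have : 0 <= n%:R * (x - 1) by rewrite mulr_ge0 // ltW.
  move=> t0; apply: (@le_trans _ _ (x * (1 + n%:R * (x - 1)))).
    by have := mulr_ge0 t0 (ltW d0); lra.
  by rewrite ler_wpM2l.
have k0 : 0 <= (c * (x - 1))^-1 by rewrite invr_ge0 mulr_ge0 // ltW.
have := archi_boundP k0; set n := Num.bound _ => hn.
have := H n; have := ler_wpM2r (ltW c0) (bern n).
have : 1 < n%:R * (c * (x - 1)) by rewrite -ltr_pdivrMr ?mul1r // mulr_gt0.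
lra.
Qed.

(** The quotient [f z / z] is continuous at the origin but not obviously
    differentiable there, whereas [f z * (f z / z) ^+ N] is.  The maximum
    principle, moved to the point [b] by a Moebius map and applied on a circle
    where that map has modulus at least [1 - e], bounds its modulus at [b] by
    [(1 - e) ^- N]; then [N] tends to infinity, and [e] to [0]. *)
Lemma schwarz_lemma (f : R[i]^o -> R[i]^o) (b : R[i]) :
  holo (unit_disc R) (unit_disc R) f -> f 0 = 0 -> cmod b < 1 -> cmod (f b) <= cmod b.
Proof.
move=> hf f0 b1.
have [->|bn0] := eqVneq b 0; first by rewrite f0.
have b0 : 0 < cmod b by rewrite cmod_gt0.
have [->|fb] := eqVneq (f b) 0; first by rewrite cmod0 cmod_ge0.
have fb0 : 0 < cmod (f b) by rewrite cmod_gt0.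
have in0 : unit_disc R 0 by change (cmod (0 : R[i]) < 1); rewrite cmod0.
have [beta df0] := differentiable_cderiv (hf 0 in0).1.
pose g (z : R[i]^o) : R[i]^o := if z == 0 then beta else f z / z.
have cg : {for 0, continuous g}.
  apply/(@cvgrPdist_le _ _ _ (nbhs (0 : R[i]^o)) (nbhs_filter _)) => e e0; have /complex_realP[d de] : e \is Num.real by exact: gtr0_real.
  have [|d' d'0 H] := df0 d; first by rewrite -ltcR -de.
  apply: (cmod_nbhs d'0) => w; rewrite /g eqxx de normr_cmod lecR.
  have [->|w0] := eqVneq w 0.
    by move=> _; rewrite subrr cmod0 -lecR -de ltW.
  move=> /H; rewrite !subr0 f0 subr0 => L.
  rewrite -(@ler_pM2r _ (cmod w)) ?cmod_gt0 //.
  by rewrite cmodB -cmodM mulrBl divfK.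
have main (e : R) : 0 < e -> e < 1 -> cmod (f b) * (1 - e) <= cmod b.
  move=> e0 e1; rewrite -[leRHS]mul1r -ler_pdivrMr //.
  apply: (@bounded_powers_le1 _ (cmod (f b))) => // [|N].
    by rewrite divr_ge0 ?cmod_ge0 // mulr_ge0 ?cmod_ge0 // subr_ge0 ltW.
  pose h (z : R[i]^o) : R[i]^o := f z * g z ^+ N.
  have dh (z : R[i]^o) : cmod z < 1 -> differentiable h z.
    move=> z1; have [->|z0] := eqVneq z 0.
      apply: cderiv_differentiable; apply: cderiv_mul_zero f0 df0 _.
      exact: continuous_pow.
    have dq : differentiable (fun z : R[i]^o => f z * (f z / z) ^+ N : R[i]^o) z.
      have dfz := (hf z z1).1.
      apply: differentiable_mul; first exact: dfz.
      apply: differentiable_pow; apply: differentiable_mul; first exact: dfz.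
      by apply: differentiable_inv.
    have [c dc] := differentiable_cderiv dq.
    apply: (@cderiv_differentiable _ _ _ c) => r r0; have [d d0 H] := dc r r0.
    exists (Num.min d (cmod z)); first by rewrite lt_min d0 cmod_gt0.
    move=> w; rewrite lt_min => /andP[wd wz].
    have w0 : w != 0 by apply: contraTneq wz => ->; rewrite sub0r cmodN ltxx.
    by rewrite /h /g (negbTE z0) (negbTE w0); apply: H.
  (* on the circle of radius r the Moebius map has modulus at least 1 - e *)
  pose r := 1 - e * (1 - cmod b) / 4.
  have p0 : 0 < e * (1 - cmod b) by rewrite mulr_gt0 // subr_gt0.
  have p1 : e * (1 - cmod b) < 1.
    have : e * (1 - cmod b) <= e * 1 by rewrite ler_pM2l //; lra.
    lra.
  have r01 : 0 < r < 1 by rewrite /r; lra.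
  have bN1 : cmod (- b) < 1 by rewrite cmodN.
  have := @cmod_center_le R (h \o moebius (- b)) r ((1 - e) ^- N) r01.
  rewrite /= moebiusN0 => /(_ _ _)/wrap[z z1|z zr|].
  - apply: differentiable_cderiv; apply: differentiable_comp.
      exact: differentiable_moebius.
    by apply: dh; exact: cmod_moebius_lt1.
  - have z1 : cmod z < 1 by rewrite zr; lra.
    set p := moebius (- b) z; have p1' : cmod p < 1 by exact: cmod_moebius_lt1.
    have p_ge : 1 - e <= cmod p.
      have := cmod_moebius_sq bN1 (ltW z1); rewrite -/p cmodN zr => Ep.
      have D := moebius_denominator_ge (- b) (ltW z1); rewrite cmodN in D.
      have D0 : 0 < 1 - cmod b by rewrite subr_gt0.
      have : (1 - cmod b ^+ 2) * (1 - r ^+ 2) / cmod (1 - (- b)^* * z) ^+ 2 <= e.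
        have D1 : 0 < cmod (1 - (- b)^* * z) by lra.
        rewrite ler_pdivrMr ?exprn_gt0 //.
        apply: (@le_trans _ _ (e * (1 - cmod b) ^+ 2)); last first.
          by rewrite ler_pM2l // ler_pXn2r // nnegrE ltW.
        have q : (1 - cmod b ^+ 2) * (1 - r ^+ 2)
          = (1 - cmod b) * ((1 + cmod b) * ((1 + r) * (1 - r))) by ring.
        have q' : e * (1 - cmod b) ^+ 2 = (1 - cmod b) * (2 * (2 * (1 - r))).
          by rewrite /r; field.
        rewrite q q' ler_pM2l //.
        apply: ler_pM; [lra | apply: mulr_ge0; lra | lra |].
        by rewrite ler_wpM2r //; lra.
      rewrite -Ep => hE.
      have : cmod p ^+ 2 <= cmod p.
        by rewrite expr2 -[leRHS]mulr1 ler_wpM2l ?cmod_ge0 // ltW.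
      lra.
    have p0' : p != 0 by rewrite -cmod_gt0; lra.
    rewrite /h /g (negbTE p0') cmodM cmodX cmodM cmodV.
    have fp : cmod (f p) < 1 by exact: (hf p p1').2.
    have e10 : 0 < 1 - e by lra.
    have q0 : 0 <= cmod (f p) / cmod p by rewrite divr_ge0 ?cmod_ge0.
    have quot : cmod (f p) / cmod p <= (1 - e)^-1.
      rewrite -[leRHS]mul1r; apply: ler_pM; [exact: cmod_ge0| |exact: ltW|].
        by rewrite invr_ge0 cmod_ge0.
      by rewrite lef_pV2 // posrE; lra.
    rewrite -[leRHS]mul1r; apply: ler_pM;
      [exact: cmod_ge0|exact: exprn_ge0|exact: ltW|].
    by rewrite -exprVn; apply: lerXn2r; rewrite ?nnegrE // invr_ge0 ltW.
  - rewrite /h /g (negbTE bn0) cmodM cmodX cmodM cmodV.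
    have u0 : 0 < (1 - e) ^+ N by rewrite exprn_gt0 // subr_gt0.
    rewrite -(ler_pM2r u0) mulVf ?gt_eqF // => L.
    by rewrite mulrAC exprMn mulrC mulrA.
rewrite leNgt; apply/negP => lt_bf.
pose e := (1 - cmod b / cmod (f b)) / 2.
have q1 : cmod b / cmod (f b) < 1 by rewrite ltr_pdivrMr // mul1r.
have q0 : 0 < cmod b / cmod (f b) by rewrite divr_gt0.
have := main e ltac:(rewrite /e; lra) ltac:(rewrite /e; lra).
rewrite mulrC -ler_pdivlMr // /e; lra.
Qed.

(** Moebius maps before and after [f] reduce to maps fixing the origin. *)
Theorem schwarz_pick (f : R[i]^o -> R[i]^o) (a b : R[i]) :
  holo (unit_disc R) (unit_disc R) f -> cmod a < 1 -> cmod b < 1 ->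
  cmod (moebius (f b) (f a)) <= cmod (moebius b a).
Proof.
move=> hf a1 b1; have fb1 : cmod (f b) < 1 by exact: (hf b b1).2.
have bN1 : cmod (- b) < 1 by rewrite cmodN.
have := @schwarz_lemma (moebius (f b) \o (f \o moebius (- b))) (moebius b a).
rewrite /= moebiusN0 moebiusvv moebiusNK //; apply => //.
  apply: holo_comp (holo_moebius fb1); apply: holo_comp hf; exact: holo_moebius.
exact: cmod_moebius_lt1.
Qed.

End SchwarzPick.

(** * Bounded holomorphic functions on the domain *)

Section MagicFunctions.
Variable R : realType.
Implicit Types (c : R) (y q z w beta : R[i]).

Lemma unimodular_mulJ w : cmod w = 1 -> w * w^* = 1.
Proof. by move=> w1; rewrite mul_conj w1 expr1n. Qed.

Lemma aligned_sum (X Y : R[i]) :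
  exists2 w, cmod w = 1 & cmod (X + w * Y) = cmod X + cmod Y.
Proof.
have [u u1 hu] := polar_form X; have [v v1 hv] := polar_form Y.
exists (u * v^*); first by rewrite cmodM cmod_conj u1 v1 mulr1.
rewrite {1}hu {1}hv (_ : _ + _ = u * ((cmod X)%:C%C + (v * v^*) * (cmod Y)%:C%C)); last by ring.
rewrite unimodular_mulJ // mul1r -real_complexD cmodM u1 mul1r cmod_real ger0_norm //.
by rewrite addr_ge0 ?cmod_ge0.
Qed.

(** With [w = q z] and [A = c - beta' z] the two sides are the moduli of
    [w A^* - beta] and [A - beta^* w], whose squares differ by
    [(|A|^2 - |beta|^2) (1 - |w|^2)]. *)
Lemma magic_numerator_lt c q beta (beta' : R[i]) z :
  cmod q < 1 -> cmod beta + cmod beta' < c -> cmod z = 1 ->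
  cmod (c%:C%C * q * z - (beta + beta'^* * q))
    < cmod ((beta' + beta^* * q) * z - c%:C%C).
Proof.
move=> q1 bc z1; set w := q * z; set A := c%:C%C - beta' * z.
have b0 := cmod_ge0 beta; have b'0 := cmod_ge0 beta'.
have zz := unimodular_mulJ z1.
have qE : q = w * z^* by rewrite -mulrA zz mulr1.
have w1 : cmod w < 1 by rewrite cmodM z1 mulr1.
have -> : c%:C%C * q * z - (beta + beta'^* * q) = w * A^* - beta.
  by rewrite /A !conjE -mulrA -/w {1}qE; ring.
have -> : (beta' + beta^* * q) * z - c%:C%C = - (A - beta^* * w) by rewrite /A /w; ring.
have Ab : cmod beta < cmod A.
  have := ler_cmodB c%:C%C (beta' * z); rewrite cmod_real cmodM z1 mulr1 -/A.
  by have := ler_norm c; lra.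
rewrite cmodN -(@ltr_pXn2r _ 2) ?nnegrE ?cmod_ge0 // -subr_gt0.
have -> : cmod (A - beta^* * w) ^+ 2 - cmod (w * A^* - beta) ^+ 2
    = (cmod A ^+ 2 - cmod beta ^+ 2) * (1 - cmod w ^+ 2).
  by rewrite !cmod_sq; case: (A) (beta) (w) => [? ?] [? ?] [? ?] /=; ring.
rewrite mulr_gt0 // subr_gt0 ?cmod_sqr_lt1 //.
by rewrite ltr_pXn2r ?nnegrE ?cmod_ge0.
Qed.

Lemma magic_coordinate_lt c q beta (beta' : R[i]) : cmod q < 1 ->
  cmod beta + cmod beta' < c -> cmod (beta' + beta^* * q) < c.
Proof.
move=> q1 bc; apply: le_lt_trans (cmodD _ _) _; rewrite cmodM cmod_conj.
have : cmod beta * cmod q <= cmod beta by rewrite ler_piMr ?cmod_ge0 // ltW.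
lra.
Qed.

(** The substitution [z = (c om + y'^* ) / (c + y' om)] of the circle turns the
    quotient into an affine function of [om], whose maximal modulus is reached
    when its two terms have the same argument. *)
Lemma magic_extremal c q y (y' : R[i]) : cmod y' < c ->
  exists2 z, cmod z = 1 &
    cmod ((c%:C%C * q * z - y) / (y' * z - c%:C%C))
    = (c * cmod (y - y'^* * q) + cmod (y * y' - c%:C%C ^+ 2 * q))
        / (c ^+ 2 - cmod y' ^+ 2).
Proof.
move=> y'c; have c0 : 0 < c by apply: le_lt_trans y'c; exact: cmod_ge0.
have [om om1 hom] := aligned_sum (c%:C%C * (y - y'^* * q)) (y * y' - c%:C%C ^+ 2 * q).
have oo := unimodular_mulJ om1.
pose D := c%:C%C + y' * om.
have nD : cmod (c%:C%C * om + y'^*) = cmod D.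
  have -> : c%:C%C * om + y'^* = om * D^*.
    by rewrite /D !conjE mulrDr mulrCA oo; ring.
  by rewrite cmodM om1 mul1r cmod_conj.
have D0 : 0 < cmod D.
  have := ler_cmodB c%:C%C (- (y' * om)); rewrite cmodN cmodM om1 mulr1 opprK -/D.
  by rewrite cmod_real ger0_norm ?(ltW c0) //; lra.
have Dn0 : D != 0 by rewrite -cmod_gt0.
have d0 : 0 < c ^+ 2 - cmod y' ^+ 2.
  by rewrite subr_gt0 ltr_pXn2r ?nnegrE ?cmod_ge0 // ltW.
have dE : (c ^+ 2 - cmod y' ^+ 2)%:C%C = c%:C%C ^+ 2 - y' * y'^*.
  by rewrite real_complexB real_complexX mul_conj.
have dn0 : c%:C%C ^+ 2 - y' * y'^* != 0.
  by rewrite -dE -cmod_gt0 cmod_real gtr0_norm.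
exists ((c%:C%C * om + y'^*) / D); first by rewrite cmodM cmodV nD divff ?gt_eqF.
have -> : (c%:C%C * q * ((c%:C%C * om + y'^*) / D) - y)
    / (y' * ((c%:C%C * om + y'^*) / D) - c%:C%C)
  = (c%:C%C * (y - y'^* * q) + om * (y * y' - c%:C%C ^+ 2 * q))
    / (c%:C%C ^+ 2 - y' * y'^*).
  rewrite /D; field; rewrite -/D Dn0 /= dn0.
  by rewrite (_ : _ + _ = - (c%:C%C ^+ 2 - y' * y'^*)) ?oppr_eq0 // /D; ring.
rewrite -dE cmodM cmodV hom cmodM !cmod_real.
by rewrite (gtr0_norm c0) (gtr0_norm d0).
Qed.

End MagicFunctions.

(** * Extremal discs in the tetrablock *)

Section Tetrablock.
Variable R : realType.
Implicit Types (a b q t w : R[i]) (s m : R).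

Definition tetrablock a b q := cmod q < 1 /\ exists beta1 beta2,
  [/\ a = beta1 + beta2^* * q, b = beta2 + beta1^* * q & cmod beta1 + cmod beta2 < 1].

Lemma tetrablockC a b q : tetrablock a b q -> tetrablock b a q.
Proof.
by move=> [q1 [b1 [b2 [-> -> lt1]]]]; split=> //; exists b2, b1; split=> //; rewrite addrC.
Qed.

Lemma tetrablock_rotate a b q w1 w2 : cmod w1 = 1 -> cmod w2 = 1 ->
  tetrablock a b q -> tetrablock (w1 * a) (w2 * b) (w1 * w2 * q).
Proof.
move=> h1 h2 [q1 [b1 [b2 [-> -> lt1]]]]; split; first by rewrite !cmodM h1 h2 !mul1r.
have e1 := unimodular_mulJ h1; have e2 := unimodular_mulJ h2.
exists (w1 * b1), (w2 * b2); rewrite !cmodM h1 h2 !mul1r; split => //.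
- rewrite conjM mulrDr; congr (_ + _).
  by rewrite -[w1 * (b2^* * q)]mul1r -e2; ring.
- rewrite conjM mulrDr; congr (_ + _).
  by rewrite -[w2 * (b1^* * q)]mul1r -e1; ring.
Qed.

Definition disc1 s kappa t : R[i] := (1 - s%:C%C) * t / (1 - s%:C%C * (kappa * t)).
Definition disc2 s kappa t : R[i] := (1 - s%:C%C) * (kappa * t) / (1 - s%:C%C * (kappa * t)).
Definition disc3 s kappa t : R[i] := t * (kappa * t - s%:C%C) / (1 - s%:C%C * (kappa * t)).

Lemma disc_denominator_neq0 s kappa t : 0 <= s <= 1 -> cmod kappa <= 1 -> cmod t < 1 ->
  1 - s%:C%C * (kappa * t) != 0.
Proof.
move=> /andP[s0 s1] k1 t1; rewrite subr_eq0 eq_sym.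
apply: contraTneq t1 => E; rewrite -leNgt.
have : cmod (s%:C%C * (kappa * t)) = 1 by rewrite E cmod1.
rewrite !cmodM cmod_real ger0_norm // => <-.
rewrite mulrA -[leRHS]mul1r ler_wpM2r ?cmod_ge0 // mulr_ile1 ?cmod_ge0 //.
Qed.

(** Let [sg = kappa t], [tau = |t|] and [r = |sg|].  The parameters [beta1],
    [beta2] of the point have moduli at most [B1 / N] and [B2 / N], and the
    difference [N - B1 - B2] is bounded below by a function that is affine in
    [s], since the terms in [s^2] cancel, and positive at [s = 0] and [s = 1]. *)
Lemma disc_tetrablock s kappa t : 0 <= s <= 1 -> cmod kappa <= 1 -> cmod t < 1 ->
  tetrablock (disc1 s kappa t) (disc2 s kappa t) (disc3 s kappa t).
Proof.
move=> hs k1 t1; have dn0 := disc_denominator_neq0 hs k1 t1.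
have /andP[s0 s1] := hs; move: dn0; rewrite /disc1 /disc2 /disc3.
set sg := kappa * t; set D := 1 - s%:C%C * sg => dn0.
pose tau := cmod t; pose r := cmod sg.
have r0 : 0 <= r := cmod_ge0 _; have tau0 : 0 <= tau := cmod_ge0 _.
have rtau : r <= tau by rewrite /r cmodM ler_piMl.
clearbody sg.
pose N := 1 - tau ^+ 2 * r ^+ 2 - s ^+ 2 * (tau ^+ 2 - r ^+ 2)
          - 2 * s * Re sg * (1 - tau ^+ 2).
have tau2 : 0 <= 1 - tau ^+ 2 by rewrite subr_ge0 ltW // cmod_sqr_lt1.
have r2 : 0 <= 1 - r ^+ 2 by rewrite subr_ge0 ltW // cmod_sqr_lt1 //; apply: le_lt_trans t1.
have rt2 : 0 <= tau ^+ 2 - r ^+ 2 by rewrite subr_ge0 ler_pXn2r.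
pose B1 := (1 - s) * (tau * (1 - r ^+ 2)).
pose B2 := (1 - s) * (r * (1 - tau ^+ 2) + s * (tau ^+ 2 - r ^+ 2)).
have gap : B1 + B2 < N.
  have hre : 2 * s * Re sg * (1 - tau ^+ 2) <= 2 * s * r * (1 - tau ^+ 2).
    by rewrite ler_wpM2r // ler_wpM2l ?Re_le_cmod // mulr_ge0.
  have t1' : tau < 1 := t1; have r1' : r < 1 by lra.
  have k0 : 0 < (1 - r * tau) * (1 - tau) * (1 - r).
    rewrite !mulr_gt0 ?subr_gt0 //; apply: le_lt_trans r1'.
    by rewrite ler_piMr // ltW.
  have k2 : 0 < (1 - tau ^+ 2) * (1 - r) ^+ 2.
    by rewrite mulr_gt0 ?exprn_gt0 ?subr_gt0 // cmod_sqr_lt1.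
  suff: 0 < (1 - s) * ((1 - r * tau) * (1 - tau) * (1 - r))
          + s * ((1 - tau ^+ 2) * (1 - r) ^+ 2) by rewrite /B1 /B2 /N; lra.
  have [s1e|s1n] := eqVneq s 1; first by rewrite s1e subrr mul0r add0r mul1r.
  rewrite ltr_pwDl //; first by rewrite mulr_gt0 // subr_gt0 lt_neqAle s1n.
  by rewrite mulr_ge0 // ltW.
have B1ge : 0 <= B1 by rewrite mulr_ge0 ?mulr_ge0 // subr_ge0.
have B2ge : 0 <= B2.
  by apply: mulr_ge0; [rewrite subr_ge0 | apply: addr_ge0; apply: mulr_ge0].
have N0 : 0 < N by lra.
have NE : N = cmod D ^+ 2 - cmod (t * (sg - s%:C%C)) ^+ 2.
  rewrite /N /tau /r cmodM exprMn !cmod_sq /D; case: (t) (sg) => [? ?] [? ?] /=; ring.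
split.
  rewrite cmodM cmodV -(@expr_lt1 _ 2) ?divr_ge0 ?cmod_ge0 //.
  rewrite expr_div_n ltr_pdivrMr ?exprn_gt0 ?cmod_gt0 // mul1r -subr_gt0 -NE //.
have NC : N%:C%C = 1 - t * t^* * (sg * sg^*) - s%:C%C ^+ 2 * (t * t^* - sg * sg^*)
      - s%:C%C * (sg + sg^*) * (1 - t * t^*).
  apply/eqP; rewrite eq_complex /N /tau /r !cmod_sq (expr2 s%:C%C).
  by case: (t) (sg) => [? ?] [? ?] /=; apply/andP; split; apply/eqP; ring.
have Nn0 : N%:C%C != 0 by rewrite -cmod_gt0 cmod_real gtr0_norm.
pose beta1 := (1 - s%:C%C) * (t * (1 - sg * sg^*)) / N%:C%C.
pose beta2 := (1 - s%:C%C) * (sg * (1 - t * t^*) + s%:C%C * (t * t^* - sg * sg^*)) / N%:C%C.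
exists beta1, beta2; split.
- rewrite /beta2 !conjE.
  rewrite /beta1; move: Nn0 dn0; rewrite NC /D => Nn0 dn0; field; rewrite dn0 Nn0 //.
- rewrite /beta1 !conjE.
  rewrite /beta2; move: Nn0 dn0; rewrite NC /D => Nn0 dn0; field; rewrite dn0 Nn0 //.
- have -> : cmod beta1 = B1 / N.
    rewrite /beta1 mul_conj cmodM cmodV cmod_real (gtr0_norm N0); congr (_ / _).
    rewrite (_ : 1 = 1%:C%C) // -!real_complexB cmodM cmod_real ger0_norm ?subr_ge0 //.
    by rewrite cmodM cmod_real (ger0_norm r2).
  apply: (@le_lt_trans _ _ (B1 / N + B2 / N)); last first.
    by rewrite -mulrDl ltr_pdivrMr // mul1r.
  rewrite lerD2l /beta2 !mul_conj cmodM cmodV cmod_real (gtr0_norm N0).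
  rewrite ler_pM2r ?invr_gt0 // (_ : 1 = 1%:C%C) // -!real_complexB cmodM cmod_real.
  rewrite ger0_norm ?subr_ge0 // ler_wpM2l ?subr_ge0 //.
  apply: le_trans (cmodD _ _) _; rewrite -real_complexM cmodM !cmod_real.
  by rewrite (ger0_norm tau2) ger0_norm // mulr_ge0.
Qed.

(** Write [X = a - b^* q], [Y = a b - q], so that [m (1 - |b|^2) = |X| + |Y|].
    On the family of discs one computes that [X] has the argument of [w1], that
    [b / a] determines [kappa], and that the point rescaled by [m] and rotated
    satisfies [a + b = 1 + q]; these three relations are solved for [w1],
    [kappa] and [w2] in turn, and the first coordinate gives [s].  The
    hypothesis [|b| <= |a|] is [|kappa| <= 1].  The cases [a = 0] and [Y = 0]
    are the extreme values [s = 1] and [s = 0]. *)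
Lemma disc_through_origin_and a b q : tetrablock a b q -> cmod b <= cmod a ->
  let m := (cmod (a - b^* * q) + cmod (a * b - q)) / (1 - cmod b ^+ 2) in
  m < 1 -> exists w1 w2 kappa s,
    [/\ cmod w1 = 1, cmod w2 = 1, cmod kappa <= 1, 0 <= s <= 1 &
     [/\ a = w1 * disc1 s kappa m%:C%C, b = w2 * disc2 s kappa m%:C%C
       & q = w1 * w2 * disc3 s kappa m%:C%C]].
Proof.
move=> [q1 [beta1 [beta2 [aE0 _ b12]]]] ba m m1.
have a1 : cmod a < 1.
  by rewrite aE0; apply: (@magic_coordinate_lt R 1) => //; rewrite addrC.
have [a0|a_neq0] := eqVneq a 0.
  have b0 : b = 0.
    by apply/eqP; rewrite -cmod_eq0 eq_le cmod_ge0 andbT; rewrite a0 cmod0 in ba.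
  have mE : m = cmod q.
    by rewrite /m a0 b0 conj0 !mul0r subrr !cmod0 sub0r cmodN expr0n subr0 divr1 add0r.
  have [w w1 qE] := polar_form q.
  exists (- w), 1, 0, 1; rewrite cmodN w1 cmod1 cmod0 ler01 lexx; split => //.
  rewrite /disc1 /disc2 /disc3 subrr !mul0r !mulr0 a0 b0 subr0 divr1; split=> //.
  by rewrite mE mulr1 sub0r mulrN1 mulrNN -qE.
have an0 : 0 < cmod a by rewrite cmod_gt0.
have b1 : cmod b < 1 by apply: le_lt_trans ba _; exact: a1.
pose X := a - b^* * q; pose Y := a * b - q; pose D := 1 - cmod b ^+ 2.
have D0 : 0 < D by rewrite subr_gt0 cmod_sqr_lt1.
have X0 : 0 < cmod X.
  have := ler_cmodB a (b^* * q); rewrite -/X cmodM cmod_conj.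
  have : cmod b * cmod q <= cmod a * cmod q by rewrite ler_wpM2r ?cmod_ge0.
  have : cmod a * cmod q < cmod a by rewrite gtr_pMr.
  lra.
have mD : m * D = cmod X + cmod Y by rewrite /m divfK ?gt_eqF.
have Y0 := cmod_ge0 Y.
have m0 : 0 < m by rewrite divr_gt0 // ltr_pwDl.
have XE : X = a - b^* * q by []. have YE : Y = a * b - q by [].
have DE : D%:C%C = 1 - b * b^* by rewrite mul_conj real_complexB.
clearbody m X Y D.
have mn0 : m%:C%C != 0 by rewrite -cmod_gt0 cmod_real gtr0_norm.
have [Yz|Y_neq0] := eqVneq Y 0.
  have qE : q = a * b by apply/eqP; rewrite eq_sym -subr_eq0 -YE Yz.
  have mE : m = cmod a.
    apply: (mulIf (lt0r_neq0 D0)); rewrite mD Yz cmod0 addr0 XE qE.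
    by rewrite (_ : a - _ = a * D%:C%C) ?DE; [rewrite -DE cmodM cmod_real gtr0_norm|ring].
  have [w w1 aE] := polar_form a.
  exists w, 1, (b / (cmod a)%:C%C), 0; rewrite cmod1 lexx ler01; split => //.
    by rewrite cmodM cmodV cmod_real gtr0_norm // ler_pdivrMr // mul1r.
  rewrite /disc1 /disc2 /disc3 !mul0r !subr0 !divr1 !mul1r -mE divfK //.
  by split; rewrite // ?mE ?qE {1}aE //; ring.
have [w1 w1m XwE] := polar_form X.
have ww1 := unimodular_mulJ w1m.
have xX : w1^* * X = (cmod X)%:C%C by rewrite {1}XwE mulrA (mulrC _ w1) ww1 mul1r.
have xX' : w1 * X^* = (cmod X)%:C%C by rewrite -[in RHS]conj_real -xX !conjE.
have Yp : 0 < cmod Y by rewrite cmod_gt0.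
pose A := m%:C%C - w1^* * a; pose N := m%:C%C * b - w1^* * q.
have mX : m%:C%C - w1 * a^* - (m%:C%C * b^* - w1 * q^*) * b = (cmod Y)%:C%C.
  have -> : m%:C%C - w1 * a^* - (m%:C%C * b^* - w1 * q^*) * b
     = (m * D)%:C%C - w1 * X^* by rewrite real_complexM DE XE !conjE; ring.
  by rewrite xX' mD real_complexD; ring.
(* the relation a + b = 1 + q for the rescaled point reads w2 * A = N *)
have NA : N * N^* = A * A^*.
  pose x := (cmod X)%:C%C; pose y := (cmod Y)%:C%C; pose M := m%:C%C.
  have MD : M * D%:C%C = x + y by rewrite -real_complexM mD real_complexD.
  have key : x ^+ 2 - y ^+ 2 = (a * a^* - q * q^*) * D%:C%C.
    by rewrite -!real_complexX -!mul_conj DE XE YE !conjE; ring.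
  have Dn0 : D%:C%C != 0 by rewrite -cmod_gt0 cmod_real gtr0_norm.
  apply/esym/(mulIf Dn0)/eqP; rewrite -subr_eq0 -mulrBl.
  have -> : A * A^* - N * N^* = M * (M * D%:C%C) - M * (w1^* * X + w1 * X^*)
      + (a * a^* - q * q^*) + (w1 * w1^* - 1) * (a * a^* - q * q^*).
    by rewrite /A /N DE XE !conjE /M; ring.
  rewrite ww1 xX xX' -/x MD subrr mul0r addr0 mulrDl -key mulrBl.
  rewrite (mulrAC M) MD (mulrAC M) MD; apply/eqP; ring.
have A_neq0 : A != 0.
  apply: contra_neq Y_neq0 => A0.
  have N0 : N = 0.
    by apply/eqP; rewrite -cmod_eq0 -sqrf_eq0; apply/eqP; apply: (@complexI R);
      rewrite -mul_conj NA A0 mul0r.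
  have aE' : a = w1 * m%:C%C.
    have -> : a = (w1 * w1^*) * a by rewrite ww1 mul1r.
    by rewrite -mulrA; congr (_ * _); apply/eqP; rewrite eq_sym -subr_eq0; apply/eqP.
  have qE' : q = w1 * m%:C%C * b.
    have -> : q = (w1 * w1^*) * q by rewrite ww1 mul1r.
    by rewrite -!mulrA; congr (_ * _); apply/eqP; rewrite eq_sym -subr_eq0; apply/eqP.
  by rewrite YE aE' qE' subrr.
pose w2 := N / A.
have w2m : cmod w2 = 1.
  apply/eqP; rewrite -(@eqrXn2 _ 2) ?cmod_ge0 // expr1n; apply/eqP; apply: (@complexI R).
  by rewrite -mul_conj /w2 conjM conjV mulrACA NA -invfM divff // mulf_neq0 // conjC_eq0.
have ww2 := unimodular_mulJ w2m.
have An0 : A^* != 0 by rewrite conjC_eq0.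
have wb : (1 - w2^* * b) * A^* = (cmod Y)%:C%C.
  by rewrite -mX /w2 /N /A !conjE; move: An0; rewrite /A !conjE => An0; field.
pose s := cmod A ^+ 2 / (m * cmod Y).
have s0 : 0 <= s by rewrite divr_ge0 ?exprn_ge0 ?cmod_ge0 // mulr_ge0 // ltW.
have sE : s%:C%C * m%:C%C * (1 - w2^* * b) = A.
  apply: (mulIf An0); rewrite -(mulrA (s%:C%C * m%:C%C)) wb mul_conj -!real_complexM; congr (_%:C%C).
  by rewrite /s; field; rewrite !gt_eqF.
pose kappa := b * w1 * w2^* / a.
have k1 : cmod kappa <= 1.
  rewrite /kappa !cmodM cmod_conj cmodV w1m w2m !mulr1 ler_pdivrMr // mul1r //.
pose sg := kappa * m%:C%C.
have sg1 : cmod sg < 1.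
  rewrite /sg cmodM cmod_real gtr0_norm //; apply: le_lt_trans m1.
  by rewrite ler_piMl // ltW.
have Ea : a * (1 - s%:C%C * sg) = w1 * m%:C%C * (1 - s%:C%C).
  have -> : w1 * m%:C%C * (1 - s%:C%C) = w1 * m%:C%C - w1 * (s%:C%C * m%:C%C * (1 - w2^* * b))
      - w1 * w2^* * b * s%:C%C * m%:C%C by ring.
  rewrite sE (_ : w1 * m%:C%C - w1 * A = (w1 * w1^*) * a); last by rewrite /A; ring.
  by rewrite ww1 mul1r /sg /kappa; field.
have Eb : b * (1 - s%:C%C * sg) = w2 * sg * (1 - s%:C%C).
  apply: (mulIf a_neq0); rewrite mulrAC -(mulrA b) (mulrC _ a) Ea.
  rewrite /sg /kappa; apply/eqP; rewrite -subr_eq0; apply/eqP.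
  rewrite (_ : _ - _ = b * w1 * m%:C%C * (1 - s%:C%C) * (1 - w2 * w2^*)); last by field.
  by rewrite ww2 subrr mulr0.
have qN : q = w1 * m%:C%C * b - w1 * w2 * m%:C%C + w2 * a.
  have : w2 * A = N by rewrite /w2 divfK.
  move=> E; have -> : q = w1 * (m%:C%C * b - N) - (w1 * w1^* - 1) * q by rewrite /N; ring.
  rewrite ww1 subrr mul0r subr0 -E /A.
  rewrite (_ : w1 * _ = w1 * m%:C%C * b - w1 * w2 * m%:C%C + w2 * (w1 * w1^*) * a); last by ring.
  by rewrite ww1 mulr1.
have Eq : q * (1 - s%:C%C * sg) = w1 * w2 * m%:C%C * (sg - s%:C%C).
  rewrite {1}qN (_ : _ * _ = w1 * m%:C%C * (b * (1 - s%:C%C * sg))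
     - w1 * w2 * m%:C%C * (1 - s%:C%C * sg) + w2 * (a * (1 - s%:C%C * sg))); last by ring.
  by rewrite Ea Eb; ring.
(* |X| |d|^2 = m (1 - s) (1 - |sg|^2), and the left side is positive *)
have s1 : s <= 1.
  rewrite leNgt; apply/negP => s1.
  pose d := 1 - s%:C%C * sg.
  have dn0 : d != 0.
    apply: contraTneq s1 => dz; rewrite -leNgt.
    have : a * d = 0 by rewrite dz mulr0.
    rewrite Ea => /eqP; rewrite !mulf_eq0 (negbTE mn0) orbF -cmod_eq0 w1m oner_eq0 /=.
    by rewrite subr_eq0 => /eqP[<-].
  have aE' : a = w1 * m%:C%C * (1 - s%:C%C) / d by rewrite -Ea mulfK.
  have bE' : b = w2 * sg * (1 - s%:C%C) / d by rewrite -Eb mulfK.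
  have qE' : q = w1 * w2 * m%:C%C * (sg - s%:C%C) / d by rewrite -Eq mulfK.
  have dcn0 : d^* != 0 by rewrite conjC_eq0.
  have dE : d = 1 - s%:C%C * sg by [].
  clearbody d sg w2.
  have xE : (cmod X)%:C%C * (d * d^*) = m%:C%C * (1 - s%:C%C) * (1 - sg * sg^*).
    rewrite -xX XE {1}aE' bE' qE' !conjE.
    rewrite (_ : w1^* * _ = (w1 * w1^*) * (m%:C%C * (1 - s%:C%C) / d)
      - (w1 * w1^*) * (w2 * w2^*) * (sg^* * (1 - s%:C%C) / d^* * (m%:C%C * (sg - s%:C%C) / d))); last by ring.
    rewrite ww1 ww2 !mul1r.
    rewrite (_ : (_ - _) * _ = m%:C%C * (1 - s%:C%C) * (d^* - sg^* * (sg - s%:C%C))); last by field; rewrite dn0 dcn0.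
    by rewrite dE !conjE; ring.
  move: xE; rewrite !mul_conj (_ : 1 = 1%:C%C) // -!real_complexB -!real_complexM => /complexI E.
  have : 0 < cmod X * cmod d ^+ 2 by rewrite mulr_gt0 // exprn_gt0 // cmod_gt0.
  rewrite E; apply/negP; rewrite -leNgt.
  have : 0 < 1 - cmod sg ^+ 2 by rewrite subr_gt0 cmod_sqr_lt1.
  move=> g0; rewrite pmulr_lle0 // pmulr_rle0 //; lra.
have hs : 0 <= s <= 1 by rewrite s0.
have dn0 : 1 - s%:C%C * sg != 0.
  by apply: disc_denominator_neq0 => //; rewrite cmod_real gtr0_norm.
exists w1, w2, kappa, s; split => //; split.
- by rewrite /disc1 -/sg; apply: (mulIf dn0); rewrite Ea; field.
- by rewrite /disc2 -/sg; apply: (mulIf dn0); rewrite Eb; field.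
- by rewrite /disc3 -/sg; apply: (mulIf dn0); rewrite Eq; field.
Qed.

End Tetrablock.

(** * The tetrablock inside the extended symmetrized polydisc *)

Section HolomorphicDiscs.
Variable R : realType.
Implicit Types (a b q : R[i]).

(** The supremum of [|a - q z| / |1 - b z|] over the circle [|z| = 1]. *)
Definition tetra_norm a b q : R :=
  (cmod (a - b^* * q) + cmod (a * b - q)) / (1 - cmod b ^+ 2).

Lemma tetrablock_cmod2_lt1 a b q : tetrablock a b q -> cmod b < 1.
Proof.
move=> [q1 [b1 [b2 [_ -> lt1]]]].
by apply: (@magic_coordinate_lt R 1).
Qed.

Lemma tetra_norm_ge0 a b q : tetrablock a b q -> 0 <= tetra_norm a b q.
Proof.
move=> /tetrablock_cmod2_lt1 b1; apply: divr_ge0; first by rewrite addr_ge0 ?cmod_ge0.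
by rewrite subr_ge0 ltW // cmod_sqr_lt1.
Qed.

Lemma tetra_norm_lt1 a b q : tetrablock a b q -> tetra_norm a b q < 1.
Proof.
move=> tE; have b1 := tetrablock_cmod2_lt1 tE.
have [q1 [be1 [be2 [aE bE lt1]]]] := tE.
have [z z1] := magic_extremal q a b1.
rewrite !expr1n !mul1r => zE; rewrite /tetra_norm.
have := @magic_numerator_lt R 1 q be1 be2 z q1 lt1 z1.
rewrite -aE -bE mul1r => lt_nd; rewrite -zE cmodM cmodV ltr_pdivrMr ?mul1r //.
by apply: le_lt_trans lt_nd; exact: cmod_ge0.
Qed.

Lemma differentiable_lin_frac (s : R) (kappa : R[i]) (f : R[i]^o -> R[i]^o) (t : R[i]^o) :
  differentiable f t -> 0 <= s <= 1 -> cmod kappa <= 1 -> cmod t < 1 ->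
  differentiable (fun t : R[i]^o => f t / (1 - s%:C%C * (kappa * t)) : R[i]^o) t.
Proof.
move=> df hs k1 t1; apply: differentiable_mul; first exact: df.
apply: differentiable_inv; last exact: disc_denominator_neq0.
apply: differentiable_sub; first exact: differentiable_cst.
apply: differentiable_mul; first exact: differentiable_cst.
by apply: differentiable_mul; [exact: differentiable_cst|exact: differentiable_id].
Qed.

Lemma tetrablock_disc a b q : tetrablock a b q -> cmod b <= cmod a ->
  exists f1 f2 f3 : R[i]^o -> R[i]^o,
  [/\ forall t : R[i]^o, cmod t < 1 ->
        [/\ differentiable f1 t, differentiable f2 t, differentiable f3 t
          & tetrablock (f1 t) (f2 t) (f3 t)],
      [/\ f1 0 = 0, f2 0 = 0 & f3 0 = 0] &
      let m := (tetra_norm a b q)%:C%C in [/\ f1 m = a, f2 m = b & f3 m = q]].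
Proof.
move=> tE ba.
have [w1 [w2 [kappa [s [h1 h2 k1 hs [aE bE qE]]]]]] :=
  disc_through_origin_and tE ba (tetra_norm_lt1 tE).
exists (fun t => w1 * disc1 s kappa t), (fun t => w2 * disc2 s kappa t),
  (fun t => w1 * w2 * disc3 s kappa t); split=> [t t1||].
- split; last by apply: tetrablock_rotate => //; exact: disc_tetrablock.
  + apply: differentiable_mul; first exact: differentiable_cst.
    apply: (@differentiable_lin_frac s kappa (fun t : R[i]^o => (1 - s%:C%C) * t : R[i]^o)); [|by []..].
    by apply: differentiable_mul; [exact: differentiable_cst|exact: differentiable_id].
  + apply: differentiable_mul; first exact: differentiable_cst.
    apply: (@differentiable_lin_frac s kappa (fun t : R[i]^o => (1 - s%:C%C) * (kappa * t) : R[i]^o)); [|by []..].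
    apply: differentiable_mul; first exact: differentiable_cst.
    by apply: differentiable_mul; [exact: differentiable_cst|exact: differentiable_id].
  + apply: differentiable_mul; first exact: differentiable_cst.
    apply: (@differentiable_lin_frac s kappa (fun t : R[i]^o => t * (kappa * t - s%:C%C) : R[i]^o)); [|by []..].
    apply: differentiable_mul; first exact: differentiable_id.
    apply: differentiable_sub; last exact: differentiable_cst.
    by apply: differentiable_mul; [exact: differentiable_cst|exact: differentiable_id].
- by rewrite /disc1 /disc2 /disc3 !(mulr0, mul0r).
- by split.
Qed.

End HolomorphicDiscs.

Lemma differentiable_ycoord (K : numFieldType) n k (y : 'rV[K]_n) :
  differentiable (fun y : 'rV[K]_n =>
    (if insub k.-1 is Some i then y ord0 i else 0) : K^o) y.
Proof.
case: insub => [i|]; last exact: differentiable_cst.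
exact: differentiable_coord.
Qed.

Section Coordinates.
Variable R : realType.
Implicit Types (n k : nat).

Lemma ycoord_ord n (y : 'rV[R[i]]_n) k (i : 'I_n) : k = i.+1 -> ycoord y k = y ord0 i.
Proof. by move=> ->; rewrite /ycoord /= valK. Qed.

Lemma ycoord_eq n (y y' : 'rV[R[i]]_n) :
  (forall k, (1 <= k <= n)%N -> ycoord y k = ycoord y' k) -> y = y'.
Proof.
move=> H; apply/rowP => i.
by rewrite -!(@ycoord_ord _ _ i.+1) // H // ltn_ord.
Qed.

Lemma ycoord0 n k : ycoord (0 : 'rV[R[i]]_n) k = 0.
Proof. by rewrite /ycoord; case: insub => [i|//]; rewrite mxE. Qed.

(** The linear parametrization of the points of [J_n] by [(a, b, q)]. *)
Definition spread n (a b q : R[i]) : 'rV[R[i]]_n := \row_(i < n)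
  if i.+1 == n then q else 'C(n, i.+1)%:R *
    (if (2 * i.+1 < n)%N then a else if (2 * i.+1 == n)%N then (a + b) / 2 else b).

Definition spread_coord n (a b : R[i]) k : R[i] := 'C(n, k)%:R *
  (if (2 * k < n)%N then a else if (2 * k == n)%N then (a + b) / 2 else b).

Lemma ycoord_spread n a b q k : (1 <= k < n)%N ->
  ycoord (spread n a b q) k = spread_coord n a b k.
Proof.
case: k => // k /= kn.
by rewrite (@ycoord_ord _ _ _ (Ordinal (ltnW kn))) // mxE /= ltn_eqF.
Qed.

Lemma ycoord_spread_last n a b q : (0 < n)%N -> ycoord (spread n a b q) n = q.
Proof.
case: n => // n _.
by rewrite (@ycoord_ord _ _ _ ord_max) // mxE /= eqxx.
Qed.

Lemma spread_decomposition n a b q :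
  spread n a b q = a *: spread n 1 0 0 + b *: spread n 0 1 0 + q *: spread n 0 0 1.
Proof.
apply/rowP => i; rewrite !mxE.
by case: ifP => _; [ring|case: ifP => _; [ring|case: ifP => _; field]].
Qed.

Lemma differentiable_spread n (f1 f2 f3 : R[i]^o -> R[i]^o) (t : R[i]^o) :
  differentiable f1 t -> differentiable f2 t -> differentiable f3 t ->
  differentiable (fun t : R[i]^o => spread n (f1 t) (f2 t) (f3 t)) t.
Proof.
move=> d1 d2 d3.
have -> : (fun t : R[i]^o => spread n (f1 t) (f2 t) (f3 t)) =
  (fun t => f1 t *: spread n 1 0 0) \+ (fun t => f2 t *: spread n 0 1 0)
  \+ (fun t => f3 t *: spread n 0 0 1).
  by apply/funext => u; rewrite [LHS]spread_decomposition.
apply: differentiableD; last exact: differentiableZl.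
by apply: differentiableD; exact: differentiableZl.
Qed.

Lemma spread0 n : spread n 0 0 0 = 0.
Proof. by rewrite spread_decomposition !scale0r !addr0. Qed.

Lemma spread_ext_sym_polydisc n a b q : (0 < n)%N -> tetrablock a b q ->
  ext_sym_polydisc R n (spread n a b q).
Proof.
move=> n0 [q1 [b1 [b2 [aE bE lt1]]]]; rewrite /ext_sym_polydisc /= ycoord_spread_last //.
split=> //; exists (spread_coord n b1 b2) => j hj.
have jn : (1 <= j < n)%N by lia.
rewrite ycoord_spread // /spread_coord.
rewrite bin_sub; last by lia.
have cc : ('C(n, j)%:R : R[i])^* = 'C(n, j)%:R by exact: rmorph_nat.
have c0 : 0 < 'C(n, j)%:R :> R by rewrite ltr0n bin_gt0; lia.
have [lt_jn|gt_jn|eq_jn] := ltngtP (2 * j)%N n.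
- have -> : (2 * (n - j) < n)%N = false by lia.
  have -> : ((2 * (n - j))%N == n) = false by lia.
  split; first by rewrite conjM cc aE; ring.
  by rewrite !cmodM cmod_nat -mulrDr gtr_pMr.
- have -> : (2 * (n - j) < n)%N by lia.
  split; first by rewrite conjM cc bE; ring.
  by rewrite !cmodM cmod_nat -mulrDr gtr_pMr // addrC.
- have -> : (2 * (n - j) < n)%N = false by lia.
  have -> : ((2 * (n - j))%N == n) by lia.
  have c2 : (2 : R[i])^* = 2 by exact: rmorph_nat.
  have mean : cmod ((b1 + b2) / 2) <= (cmod b1 + cmod b2) / 2.
    by rewrite cmodM cmodV cmod_nat ler_pM2r ?invr_gt0 // cmodD.
  split; first by rewrite conjM cc conjM conjV c2 conjD aE bE; field.
  by rewrite (cmodM 'C(n, j)%:R) cmod_nat -mulrDr gtr_pMr //; lra.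
Qed.

Lemma ext_sym_polydisc_tetrablock n (y : 'rV[R[i]]_n) : (1 < n)%N ->
  ext_sym_polydisc R n y ->
  tetrablock (ycoord y 1 / n%:R) (ycoord y n.-1 / n%:R) (ycoord y n).
Proof.
move=> n1 [q1 [beta H]]; split=> //.
exists (beta 1%N / n%:R), (beta n.-1 / n%:R).
have cn : (n%:R : R[i])^* = n%:R by exact: rmorph_nat.
have n0 : 0 < n%:R :> R by rewrite ltr0n; lia.
have [|E1 L] := H 1%N; first by lia.
have [|E2 _] := H n.-1; first by lia.
rewrite subn1 bin1 in E1 L; rewrite (_ : (n - n.-1 = 1)%N) in E2; last by lia.
rewrite !conjE cn E1 E2; split.
- by rewrite mulrDl; congr (_ + _); rewrite mulrAC.
- by rewrite mulrDl; congr (_ + _); rewrite mulrAC.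
- by rewrite !cmodM cmodV cmod_nat -mulrDl ltr_pdivrMr // mul1r.
Qed.

Lemma Jset_spread n (y : 'rV[R[i]]_n) : (3 <= n)%N -> Jset R n y ->
  y = spread n (ycoord y 1 / n%:R) (ycoord y n.-1 / n%:R) (ycoord y n).
Proof.
move=> n3 [_ hJ hmid]; apply: ycoord_eq => k hk.
have n0 : (n%:R : R[i]) != 0 by rewrite pnatr_eq0; lia.
have [kn|kn] := eqVneq k n; first by rewrite kn ycoord_spread_last //; lia.
rewrite ycoord_spread /spread_coord; last by lia.
have [lt_kn|gt_kn|eq_kn] := ltngtP (2 * k)%N n.
- have [->|k1] := eqVneq k 1%N; first by rewrite bin1 mulrC divfK.
  have [|-> _] := hJ k; first by case: ifP; lia.
  by rewrite mulrAC -mulrA.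
- have [->|k1] := eqVneq k n.-1.
    rewrite -subn1 bin_sub; last by lia.
    by rewrite bin1 mulrC divfK.
  have [|_ E] := hJ (n - k)%N; first by case: ifP; lia.
  rewrite subKn in E; last by lia.
  rewrite E bin_sub; last by lia.
  by rewrite mulrAC -mulrA.
- have odd_n : ~~ odd n by lia.
  have -> : k = n./2 by lia.
  by rewrite hmid // natrM; field; rewrite n0.
Qed.

End Coordinates.

(** * Comparison of the distances *)

Section Distances.
Variable R : realType.

Lemma le_atanh (x x' : R) : 0 <= x -> x <= x' -> x' < 1 -> atanh x <= atanh x'.
Proof.
move=> x0 xx' x'1; rewrite /atanh ler_pM2r ?invr_gt0 // ler_ln ?posrE ?divr_gt0 //; try lra.
rewrite ler_pdivrMr; last by lra.
rewrite mulrAC ler_pdivlMr; last by lra.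
nra.
Qed.

Lemma rho0z (w : R[i]) : rho 0 w = atanh (cmod w).
Proof. by rewrite /rho mulr0 subr0 divr1 sub0r cmodN. Qed.

Lemma caratheodory_le_lempert (V : normedModType R[i]) (Omega : set V) (z w : V) :
  (caratheodory Omega z w <= lempert Omega z w)%E.
Proof.
apply: ge_ereal_sup => _ [f hf <-]; apply: le_ereal_inf_tmp => _ [a [b [a1 b1 [phi [hphi <- <-]] ->]]].
have fp := holo_comp hphi hf.
rewrite lee_fin !rho_moebius; apply: le_atanh; first exact: cmod_ge0.
  exact: (schwarz_pick fp).
exact: cmod_moebius_lt1.
Qed.

Lemma le_caratheodory n (y : 'rV[R[i]]_n) j : (1 <= j < n)%N ->
  ext_sym_polydisc R n y ->
  Order.le
    (atanh ((('C(n, j)%:R * cmod (ycoord y j - (ycoord y (n - j))^* * ycoord y n))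
                 + cmod (ycoord y j * ycoord y (n - j)
                         - 'C(n, j)%:R ^+ 2 * ycoord y n))
                / ('C(n, j)%:R ^+ 2 - cmod (ycoord y (n - j)) ^+ 2)))%:E
    (caratheodory (ext_sym_polydisc R n) 0 y).
Proof.
move=> hj hy; set c := 'C(n, j)%:R : R.
have cE : ('C(n, j)%:R : R[i]) = c%:C%C by rewrite /c rmorph_nat.
have pair (x : 'rV[R[i]]_n) : ext_sym_polydisc R n x -> cmod (ycoord x n) < 1 /\
    exists be1 be2, [/\ ycoord x j = be1 + be2^* * ycoord x n,
      ycoord x (n - j) = be2 + be1^* * ycoord x n & cmod be1 + cmod be2 < c].
  move=> [q1 [beta H]]; split=> //; exists (beta j), (beta (n - j)%N).
  have [|E1 L] := H j; first by lia.
  have [|E2 _] := H (n - j)%N; first by lia.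
  by rewrite subKn in E2; [|lia].
have [z z1 zE] : exists2 z, cmod z = 1 & cmod ((c%:C%C * ycoord y n * z - ycoord y j)
    / (ycoord y (n - j) * z - c%:C%C)) = (c * cmod (ycoord y j - (ycoord y (n - j))^* * ycoord y n)
    + cmod (ycoord y j * ycoord y (n - j) - c%:C%C ^+ 2 * ycoord y n))
    / (c ^+ 2 - cmod (ycoord y (n - j)) ^+ 2).
  apply: magic_extremal; have [q1 [be1 [be2 [_ -> lt]]]] := pair y hy.
  exact: magic_coordinate_lt.
pose F (x : 'rV[R[i]]_n) : R[i]^o :=
  (c%:C%C * ycoord x n * z - ycoord x j) / (ycoord x (n - j) * z - c%:C%C).
have F0 : F 0 = 0 by rewrite /F !ycoord0 mulr0 mul0r subrr mul0r.
rewrite cE -zE -rho0z -{1}F0; apply: ereal_sup_ubound; exists F => // x hx.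
have [q1 [be1 [be2 [E1 E2 lt]]]] := pair x hx.
have lt_nd := magic_numerator_lt q1 lt z1; rewrite -E1 -E2 in lt_nd.
have d0 : 0 < cmod (ycoord x (n - j) * z - c%:C%C).
  by apply: le_lt_trans lt_nd; exact: cmod_ge0.
split; last by rewrite /unit_disc /= /F cmodM cmodV ltr_pdivrMr ?mul1r.
have dy k := @differentiable_ycoord R[i] n k x.
apply: differentiable_mul.
  apply: differentiable_sub; last exact: dy.
  apply: differentiable_mul; last exact: differentiable_cst.
  by apply: differentiable_mul; [exact: differentiable_cst|exact: dy].
apply: differentiable_inv; last by rewrite -cmod_gt0.
apply: differentiable_sub; last exact: differentiable_cst.
by apply: differentiable_mul; [exact: dy|exact: differentiable_cst].
Qed.

Lemma lempert_le_disc n (y : 'rV[R[i]]_n) (f1 f2 f3 : R[i]^o -> R[i]^o) (m : R) :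
  (0 < n)%N -> 0 <= m < 1 ->
  (forall t : R[i]^o, cmod t < 1 ->
        [/\ differentiable f1 t, differentiable f2 t, differentiable f3 t
          & tetrablock (f1 t) (f2 t) (f3 t)]) ->
  [/\ f1 0 = 0, f2 0 = 0 & f3 0 = 0] ->
  y = spread n (f1 m%:C%C) (f2 m%:C%C) (f3 m%:C%C) ->
  (lempert (ext_sym_polydisc R n) 0%R y <= (atanh m)%:E)%E.
Proof.
move=> n0 /andP[m0 m1] hf [z1 z2 z3] yE.
have cm : cmod m%:C%C = m by rewrite cmod_real ger0_norm.
apply: ereal_inf_lbound; exists 0, m%:C%C; split.
- by change (cmod (0 : R[i]) < 1); rewrite cmod0.
- by change (cmod m%:C%C < 1); rewrite cm.
- exists (fun t => spread n (f1 t) (f2 t) (f3 t)); split=> //.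
    move=> t /hf[d1 d2 d3 tE]; split; last exact: spread_ext_sym_polydisc.
    exact: differentiable_spread.
  by rewrite z1 z2 z3 spread0.
- by rewrite rho0z cm.
Qed.

Lemma tetra_norm_scaled (c : R) (y y' q : R[i]) : 0 < c ->
  tetra_norm (y / c%:C%C) (y' / c%:C%C) q =
    (c * cmod (y - y'^* * q) + cmod (y * y' - c%:C%C ^+ 2 * q)) / (c ^+ 2 - cmod y' ^+ 2).
Proof.
move=> c0; have cn0 : c%:C%C != 0 by rewrite -cmod_gt0 cmod_real gtr0_norm.
have cm : cmod c%:C%C = c by rewrite cmod_real gtr0_norm.
rewrite /tetra_norm !conjE.
have -> : y / c%:C%C - y'^* / c%:C%C * q = (y - y'^* * q) / c%:C%C by field.
have -> : y / c%:C%C * (y' / c%:C%C) - q = (y * y' - c%:C%C ^+ 2 * q) / c%:C%C ^+ 2 by field.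
rewrite !cmodM !cmodV cmodX cm.
have -> : 1 - (cmod y' / c) ^+ 2 = (c ^+ 2 - cmod y' ^+ 2) / c ^+ 2.
  by field; lra.
rewrite invf_div mulrCA mulrA; congr (_ / _); field; lra.
Qed.

End Distances.

Theorem theorem4p1 (R : realType) (n : nat) (y : 'rV[R[i]]_n)
    (hn : (3 <= n)%N) (hy : Jset R n y) :
  caratheodory (ext_sym_polydisc R n) 0 y
    = lempert (ext_sym_polydisc R n) 0 y /\
  lempert (ext_sym_polydisc R n) 0 y
    = \big[maxe/-oo%E]_(1 <= j < n)
        (atanh ((('C(n, j)%:R * cmod (ycoord y j
                                      - (ycoord y (n - j))^* * ycoord y n))
                 + cmod (ycoord y j * ycoord y (n - j)
                         - 'C(n, j)%:R ^+ 2 * ycoord y n))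
                / ('C(n, j)%:R ^+ 2 - cmod (ycoord y (n - j)) ^+ 2)))%:E.
Proof.
pose F (j : nat) : \bar R :=
  (atanh ((('C(n, j)%:R * cmod (ycoord y j - (ycoord y (n - j))^* * ycoord y n))
           + cmod (ycoord y j * ycoord y (n - j) - 'C(n, j)%:R ^+ 2 * ycoord y n))
          / ('C(n, j)%:R ^+ 2 - cmod (ycoord y (n - j)) ^+ 2)))%:E.
have hG : ext_sym_polydisc R n y by case: hy.
have n0 : 0 < n%:R :> R by rewrite ltr0n; lia.
have nC : (n%:R : R[i]) = n%:R%:C%C by rewrite rmorph_nat.
set C := caratheodory _ _ _; set L := lempert _ _ _.
pose M := \big[maxe/-oo%E]_(1 <= j < n) F j.
change (C = L /\ L = M).
have CL : (C <= L)%E by exact: caratheodory_le_lempert.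
have MC : (M <= C)%E.
  rewrite /M big_seq; apply: bigmax_le; first exact: leNye.
  by move=> j; rewrite mem_index_iota => hj; exact: le_caratheodory.
have FM j : (1 <= j < n)%N -> (F j <= M)%E.
  by move=> hj; apply: le_bigmax_seq => //; rewrite mem_index_iota.
(* the terms of index 1 and n - 1 are the two norms of the tetrablock, and the
   larger of |a| and |b| decides which one bounds the Lempert function *)
have LM : (L <= M)%E.
  have yE := Jset_spread hn hy.
  have tE := ext_sym_polydisc_tetrablock (ltnW hn) hG.
  have [ba|/ltW ab] := leP (cmod (ycoord y n.-1 / n%:R)) (cmod (ycoord y 1 / n%:R)).
  - have [f1 [f2 [f3 [hf f0 [e1 e2 e3]]]]] := tetrablock_disc tE ba.
    apply: le_trans (FM 1%N _); last by lia.
    have -> : F 1%N = (atanh (tetra_norm (ycoord y 1 / n%:R) (ycoord y n.-1 / n%:R) (ycoord y n)))%:E.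
      by rewrite /F bin1 subn1 nC tetra_norm_scaled.
    apply: lempert_le_disc hf f0 _; first by lia.
    + by rewrite tetra_norm_ge0 ?tetra_norm_lt1.
    + by rewrite e1 e2 e3.
  - have tE' := tetrablockC tE.
    have [f1 [f2 [f3 [hf [z1 z2 z3] [e1 e2 e3]]]]] := tetrablock_disc tE' ab.
    apply: le_trans (FM n.-1 _); last by lia.
    have binE : 'C(n, n.-1) = n by rewrite -subn1 bin_sub ?bin1 //; lia.
    have -> : F n.-1 = (atanh (tetra_norm (ycoord y n.-1 / n%:R) (ycoord y 1 / n%:R) (ycoord y n)))%:E.
      rewrite /F binE (_ : (n - n.-1 = 1)%N); last by lia.
      by rewrite nC tetra_norm_scaled.
    apply: (@lempert_le_disc _ _ _ f2 f1 f3); first by lia.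
    + by rewrite tetra_norm_ge0 ?tetra_norm_lt1.
    + by move=> t /hf[d1 d2 d3 /tetrablockC ?].
    + by [].
    + by rewrite e1 e2 e3.
have E : C = L by apply/eqP; rewrite eq_le CL (le_trans LM MC).
by split=> //; apply/eqP; rewrite eq_le LM -E MC.
Qed.
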